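(* For all constants $c>0$ and $d>1$ there exists $\kappa_0=\kappa_0(c,d)>0$ such that the following holds for every $\rho\in\mathbb{R}\setminus\mathbb{Q}$ satisfying the Diophantine condition $\mathrm{dist}(n\rho,\mathbb{Z})\geq c\,n^{-d}$ for all integers $n\geq 1$, and for every $\kappa\geq\kappa_0$. Let $\varphi^+$ be the upper bounding graph of the map $F_\kappa(\theta,x)=(\theta+\rho \bmod 1,\ \tanh(\kappa x)\cdot\sin(\pi\theta))$ on $\mathbb{T}^1\times[0,1]$ and $\mu_{\varphi^+}$ the associated invariant measure. Then the information dimension of $\mu_{\varphi^+}$ exists and $D_1(\mu_{\varphi^+})=1$.
   Context: $\mathbb{T}^1=\mathbb{R}/\mathbb{Z}$ with its usual metric, and in $\sin(\pi\theta)$ the point $\theta\in\mathbb{T}^1$ is represented in $[0,1)$. The space $\mathbb{T}^1\times[0,1]$ carries the usual product metric. The global attractor is $\mathcal{A}=\bigcap_{n\in\mathbb{N}}F_\kappa^n(\mathbb{T}^1\times[0,1])$. The upper bounding graph is $\varphi^+:\mathbb{T}^1\to[0,1]$, $\varphi^+(\theta)=\sup\{x\in[0,1]\mid(\theta,x)\in\mathcal{A}\}$, with point set $\Phi^+=\{(\theta,\varphi^+(\theta))\mid\theta\in\mathbb{T}^1\}$. The measure $\mu_{\varphi^+}$ is defined by $\mu_{\varphi^+}(A)=\mathrm{Leb}_{\mathbb{T}^1}(\pi_1(A\cap\Phi^+))$ for Borel sets $A\subseteq\mathbb{T}^1\times[0,1]$, where $\pi_1$ is the projection to the first coordinate. For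 a finite Borel measure $\mu$ on a separable metric space, the lower and upper information dimensions are the $\liminf$ and $\limsup$, as $\varepsilon\to0$, of $\frac{\int\log\mu(B_\varepsilon(x))\,d\mu(x)}{\log\varepsilon}$, where $B_\varepsilon(x)$ is the open $\varepsilon$-ball; if they coincide, the common value is the information dimension $D_1(\mu)$. *)

(* Defs.v *)
From HB Require Import structures.
From mathcomp Require Import all_boot all_order all_algebra.
From mathcomp Require Import all_classical all_reals all_analysis.
From mathcomp Require Import lra.

Set Implicit Arguments.
Unset Strict Implicit.
Unset Printing Implicit Defensive.

Import Order.TTheory GRing.Theory Num.Theory.
Import numFieldNormedType.Exports.

Local Open Scope classical_set_scope.
Local Open Scope ring_scope.

Section dist_int.
Context {R : realType}.
Implicit Types x y : R.

Definition dist_int x : R := inf [set `|x - m%:~R| | m in [set: int]].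

Let dset_lb x : has_lbound [set `|x - m%:~R| | m in [set: int]].
Proof. by exists 0 => _ [m _ <-]; exact: normr_ge0. Qed.

Let dset_n0 x : [set `|x - m%:~R| | m in [set: int]] !=set0.
Proof. by exists `|x - 0%:~R|, 0. Qed.

Lemma dist_int_le x (m : int) : dist_int x <= `|x - m%:~R|.
Proof. by apply: ge_inf; [exact: dset_lb|exists m]. Qed.

Lemma le_dist_int x (b : R) :
  (forall m : int, b <= `|x - m%:~R|) -> b <= dist_int x.
Proof.
by move=> bP; apply: lb_le_inf; [exact: dset_n0|move=> _ [m _ <-]; exact: bP].
Qed.

Lemma dist_int_ge0 x : 0 <= dist_int x.
Proof. by apply: le_dist_int => m; exact: normr_ge0. Qed.

Lemma dist_int0 : dist_int 0 = 0.
Proof.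
apply/eqP; rewrite eq_le dist_int_ge0 andbT.
by rewrite (le_trans (dist_int_le _ 0))// mulr0z subrr normr0.
Qed.

Lemma dist_intN x : dist_int (- x) = dist_int x.
Proof.
apply/eqP; rewrite eq_le; apply/andP; split; apply: le_dist_int => m.
  rewrite (le_trans (dist_int_le _ (- m)))//.
  by rewrite mulrNz -opprD normrN.
rewrite (le_trans (dist_int_le _ (- m)))//.
by rewrite mulrNz -normrN opprD !opprK.
Qed.

Lemma dist_intD x y : dist_int (x + y) <= dist_int x + dist_int y.
Proof.
rewrite -lerBlDr; apply: le_dist_int => m; rewrite lerBlDr -lerBlDl.
apply: le_dist_int => n; rewrite lerBlDl.
rewrite (le_trans (dist_int_le _ (m + n)))// intrD opprD addrACA.
exact: ler_normD.
Qed.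

Lemma dist_int_eq0 x : `|x| < 1 -> dist_int x = 0 -> x = 0.
Proof.
move=> x1 x0; apply/eqP/negPn/negP => xn0.
have : Num.min `|x| (1 - `|x|) <= dist_int x.
  apply: le_dist_int => m; rewrite ge_min.
  have [->|m0] := eqVneq m 0; first by rewrite mulr0z subr0 lexx.
  apply/orP; right; rewrite distrC.
  apply: le_trans (lerB_dist _ _); rewrite lerD2r -intr_norm.
  by rewrite ler1z -gtz0_ge1 normr_gt0.
by rewrite x0 leNgt lt_min normr_gt0 xn0 subr_gt0 x1.
Qed.

End dist_int.

(* A point of R/Z is given by its representative in [0, 1). *)
Record circle (R : realType) := Circle {
  circle_val : R ;
  circle_valP : 0 <= circle_val < 1 }.

Section circle.
Context {R : realType}.

HB.instance Definition _ := [isSub for @circle_val R].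
HB.instance Definition _ := [Choice of circle R by <:].

Lemma frac_part_itv (x : R) : 0 <= x - (Num.floor x)%:~R < 1.
Proof.
by rewrite subr_ge0 floor_le ltrBlDl -intrD1 floorD1_gt.
Qed.

Definition to_circle (x : R) : circle R := Circle (frac_part_itv x).

HB.instance Definition _ := isPointed.Build (circle R) (to_circle 0).

Definition circle_dist (s t : circle R) : R :=
  dist_int (circle_val s - circle_val t).

Let circle_distxx s : circle_dist s s = 0.
Proof. by rewrite /circle_dist subrr dist_int0. Qed.

Let circle_dist_positivity s t : circle_dist s t = 0 -> s = t.
Proof.
move=> /dist_int_eq0 st; apply/val_inj/eqP; rewrite -subr_eq0; apply/eqP/st.
move: (circle_valP s) (circle_valP t) => /andP[s0 s1] /andP[t0 t1].
by rewrite ltr_norml; lra.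
Qed.

Let circle_dist_sym s t : circle_dist s t = circle_dist t s.
Proof. by rewrite /circle_dist -dist_intN opprB. Qed.

Let circle_dist_triangle t s u :
  circle_dist s u <= circle_dist s t + circle_dist t u.
Proof.
rewrite /circle_dist; apply: le_trans (dist_intD _ _).
by rewrite addrA subrK.
Qed.

HB.instance Definition _ := isMetric.Build R (circle R)
  circle_distxx circle_dist_positivity circle_dist_sym circle_dist_triangle.

Definition circle_lebesgue (B : set (circle R)) : \bar R :=
  lebesgue_measure (@circle_val R @` B).

End circle.

Section unit_interval.
Variable R : realType.

Definition unit_interval : Type := set_type (`[0, 1]%classic : set R).

Lemma unit_interval0_subproof : (0 : R) \in (`[0, 1]%classic : set R).
Proof. by rewrite inE/= in_itv/= lexx ler01. Qed.

HB.instance Definition _ := PseudoMetric.on unit_interval.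
HB.instance Definition _ :=
  isPointed.Build unit_interval (exist _ 0 unit_interval0_subproof).

(* The library's metric on a product is the maximum of the two metrics. *)
Definition phase_space : Type := (circle R * unit_interval)%type.

HB.instance Definition _ := PseudoMetric.on phase_space.
HB.instance Definition _ := Pointed.on phase_space.

End unit_interval.

Definition borel (T : ptopologicalType) := g_sigma_algebraType (@open T).

Section information_dimension.
Context {R : realType} {T : pseudoPMetricType R}.
Local Open Scope ereal_scope.

Definition information_ratio (mu : set (borel T) -> \bar R) (eps : R) : \bar R :=
  (\int[mu]_x lne (mu (ball (x : T) eps)))
    / (ln eps)%:E.

Definition lower_information_dimension (mu : set (borel T) -> \bar R) : \bar R :=
  limf_einf (information_ratio mu) 0^'+.

Definition upper_information_dimension (mu : set (borel T) -> \bar R) : \bar R :=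
  limf_esup (information_ratio mu) 0^'+.

Definition has_information_dimension (mu : set (borel T) -> \bar R) (D : \bar R) :=
  lower_information_dimension mu = D /\ upper_information_dimension mu = D.

End information_dimension.

Section skew_product.
Context {R : realType}.

Definition tanh (x : R) : R :=
  (expR x - expR (- x)) / (expR x + expR (- x)).

Definition fibre_map (kappa : R) (theta : circle R) (x : R) : R :=
  tanh (kappa * x) * sin (pi * circle_val theta).

Lemma fibre_map_unit (kappa : {posnum R}) (theta : circle R)
    (x : unit_interval R) :
  fibre_map kappa%:num theta (\val x) \in (`[0, 1]%classic : set R).
Proof.
have : 0 <= \val x by case: x => x /=; rewrite inE/= in_itv/= => /andP[].
move: (\val x) => {}x x0.
have kx0 : 0 <= kappa%:num * x by rewrite mulr_ge0.
have e0 := expR_gt0 (kappa%:num * x).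
have eN0 := expR_gt0 (- (kappa%:num * x)).
have eNe : expR (- (kappa%:num * x)) <= expR (kappa%:num * x).
  by rewrite ler_expR; lra.
have tanh0 : 0 <= tanh (kappa%:num * x).
  by rewrite /tanh divr_ge0 ?subr_ge0// addr_ge0 ?expR_ge0.
have tanh1 : tanh (kappa%:num * x) <= 1.
  by rewrite /tanh ler_pdivrMr ?mul1r; lra.
have sin0 : 0 <= sin (pi * circle_val theta).
  have /andP[t0 t1] := circle_valP theta.
  rewrite sin_ge0_pi// mulr_ge0 ?pi_ge0//=.
  by rewrite ler_piMr ?pi_ge0// ltW.
by rewrite inE/= in_itv/= /fibre_map mulr_ge0//= mulr_ile1// sin_le1.
Qed.

(* kappa is positive so that the map sends the unit interval to itself. *)
Definition skew_map (rho : R) (kappa : {posnum R}) (p : phase_space R) :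
    phase_space R :=
  (to_circle (circle_val p.1 + rho),
   exist _ (fibre_map kappa%:num p.1 (\val p.2)) (fibre_map_unit kappa p.1 p.2)).

Definition global_attractor (rho : R) (kappa : {posnum R}) :
    set (phase_space R) :=
  \bigcap_(n in [set: nat]) (iter n (skew_map rho kappa) @` [set: phase_space R]).

Section upper_bounding_graph.
Variables (rho : R) (kappa : {posnum R}).
Implicit Types theta : circle R.

Definition attractor_fibre theta : set R :=
  [set \val x | x in [set x : unit_interval R |
                       global_attractor rho kappa (theta, x)]].

Lemma sup_attractor_fibre_unit theta :
  sup (attractor_fibre theta) \in (`[0, 1]%classic : set R).
Proof.
have ub1 : ubound (attractor_fibre theta) 1.
  by move=> _ [[x /= +] _ <-] /=; rewrite inE/= in_itv/= => /andP[].
rewrite inE/= in_itv/=.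
have [->|/set0P fn0] := eqVneq (attractor_fibre theta) set0.
  by rewrite sup0 lexx ler01.
apply/andP; split; last exact: ge_sup.
case: fn0 => y fy; apply: (@le_trans _ _ y).
  by case: fy => -[x /= +] _ <- /=; rewrite inE/= in_itv/= => /andP[].
by apply: ub_le_sup => //; exists 1.
Qed.

Definition upper_graph_fun theta : unit_interval R :=
  exist _ (sup (attractor_fibre theta)) (sup_attractor_fibre_unit theta).

Definition upper_graph : set (phase_space R) :=
  [set (theta, upper_graph_fun theta) | theta in [set: circle R]].

Definition upper_graph_measure (A : set (phase_space R)) : \bar R :=
  circle_lebesgue (fst @` (A `&` upper_graph)).

End upper_bounding_graph.

Definition diophantine (c d rho : R) : Prop :=
  forall n : nat, (1 <= n)%N -> c * n%:R `^ (- d) <= dist_int (n%:R * rho).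

End skew_product.

(* Main.v *)
Require Import Defs.
From mathcomp Require Import all_boot all_order all_algebra.
From mathcomp Require Import all_classical all_reals all_analysis measurable_realfun.
From mathcomp Require Import zify ring lra.

Set Implicit Arguments.
Unset Strict Implicit.
Unset Printing Implicit Defensive.

Import Order.TTheory GRing.Theory Num.Theory.
Import numFieldNormedType.Exports.

Local Open Scope classical_set_scope.
Local Open Scope ring_scope.

(** The ball of radius [e] around a point of the graph projects into an arc of
    length of order [e], so its mass is at most of order [e]; hence the lower
    information dimension of the graph measure is at least 1.  The content of
    the theorem is the converse bound, which follows from a Lusin-type property:
    for every [delta], the upper bounding graph is Lipschitz on a set [A] whose
    complement has measure at most [delta] ([upper_line_lipschitz_large]).

    _From Lipschitz to dimension._  If a cell of mass [p] is contained in the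
    ball of radius [e] around each of its graph points, then the information
    [- ln (mass of the ball)] integrates over the cell to at most
    [- p * ln p <= w - p * ln w], for any guess [w > 0] ([integral_cell]).
    On [A], of order [1 / e] cells suffice, and [w = e]; on the complement of
    [A], of order [1 / e ^+ 2] cells suffice, and [w = e ^+ 2].  Summing, the
    integral of the information is at most
    [(1 + 2 * delta) * - ln e + C(delta)] ([information_upper]); divide by
    [- ln e], let [e] tend to 0, then [delta].

    _Lipschitz property._  Let [y j] be the height over [t - j * rho] of the
    orbit that starts at height 1 in the past and ends over [t].  Since
    [tanh u >= min u 1 / 2], one has
    [y j >= min (kappa * y (j+1)) 1 * s (j+1)], where
    [s j = |sin (pi * (t - j * rho))| / 2].  If the products of the first
    [j] of the [s i] are at least [b * q ^+ j] for all [j], and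
    [kappa * q >= 1], this recursion shows that the products of the
    [min kappa (y i)^-1] are at most [(b * q ^+ (j+1))^-1] ([prod_min_inv]): the
    orbit cannot stay near the zero line for long.  On the other hand, a fibre
    map at height [x] has slope at most [kappa^-1 * (min kappa x^-1) ^+ 4]
    ([tanh_contraction]).  So once [kappa * q ^+ 8 >= 2], the contraction factors
    along a pair of orbits multiply to [O(2 ^- j)], and the errors of size
    [pi * |t - u|] made at each step add up to a multiple of [|t - u|]
    ([pullback1_lipschitz]).

    _Products along the orbit._  The set [A] consists of the [t] with
    [dist (t - i * rho) >= a * 2 ^- i] for all [i >= 1], for a small [a]; by a union bound it
    misses at most measure [6 * a].  By the Diophantine condition, two
    close visits to 0 at scale [2 ^- (D * k)], with [D >= d], are separated in
    time by at least a constant times [2 ^ k], so a dyadic layer-cake count gives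
    the lower bound [b * q ^+ n] for the products, where [q] depends only on the
    Diophantine constants ([prod_dist_int_lower]).  This is what makes the
    threshold for [kappa] uniform in [rho]. *)

(** * Products of distances along a Diophantine orbit *)

(** A set of positive integers with gaps at least [p] has at most [n / p + 1]
    elements up to [n]. *)
Lemma count_spaced (P : pred nat) (p n : nat) :
  (forall i j, (0 < i < j)%N -> P i -> P j -> (p <= j - i)%N) ->
  (p * \sum_(1 <= i < n.+1) P i <= n + p)%N.
Proof.
case: p => [|p] spaced; first by rewrite mul0n.
elim/ltn_ind: n => n IH.
case: n IH => [|n] IH; first by rewrite big_geq// muln0.
rewrite big_nat_recr//=; case: (boolP (P n.+1)) => Pn /=; last first.
  by have := IH n (ltnSn n); lia.
have gap i : (0 < i < n.+1)%N -> P i -> (i <= n.+1 - p.+1)%N.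
  by move=> i1 Pi; have := spaced i n.+1 i1 Pi Pn; lia.
have [pn|np] := leqP p.+1 n; last first.
  rewrite big_nat big1 => [|i i1]; first by lia.
  by case: (boolP (P i)) => // Pi; have := gap i i1 Pi; lia.
rewrite (@big_cat_nat _ _ _ (n.+1 - p.+1).+1)/=; try lia.
rewrite [X in (_ + X + _)%N]big_nat [X in (_ + X + _)%N]big1; last first.
  move=> i i1; case: (boolP (P i)) => // Pi.
  by have := gap i _ Pi; lia.
by have := IH (n.+1 - p.+1)%N; lia.
Qed.

Lemma sum_geometric_counts (f : nat -> nat) (m n : nat) :
  (forall k, (2 ^ k * f k <= n + 2 ^ k)%N) ->
  (\sum_(k < m) f k <= m + 2 * n)%N.
Proof.
move=> fP.
suff : (2 ^ m * \sum_(k < m) f k <= 2 ^ m * m + (2 ^ m - 1) * (2 * n))%N.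
  move=> H; rewrite -(@leq_pmul2l (2 ^ m)) ?expn_gt0//.
  by apply: (leq_trans H); rewrite mulnDr leq_add2l leq_mul2r leq_subr orbT.
elim: m => [|m IH]; first by rewrite big_ord0; lia.
rewrite big_ord_recr/= expnS.
have := fP m; have : (0 < 2 ^ m)%N by rewrite expn_gt0.
move: IH; set s := (\sum_(i < m) _)%N; set x := (2 ^ m)%N => IH x0 fm.
by nia.
Qed.

(** A dyadic layer-cake bound: if indices whose level is at least [k] are
    [2 ^ (k - e)]-separated, then the levels have bounded average. *)
Lemma sum_levels (K : nat -> nat) (e B n : nat) :
  (forall i j k, (0 < i < j)%N -> (k <= K i)%N -> (k <= K j)%N ->
    (2 ^ k <= 2 ^ e * (j - i))%N) ->
  (forall i, (0 < i)%N -> (K i <= i + B)%N) ->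
  (\sum_(1 <= i < n.+1) K i <= n * (e + 3) + B)%N.
Proof.
move=> spaced KB.
have layer x : (x <= n + B)%N -> (x <= e + \sum_(k < n + B) (e + k < x))%N.
  move=> xnB.
  suff -> : (\sum_(k < n + B) (e + k < x) = minn (n + B) (x - e))%N by lia.
  elim: (n + B)%N => [|m IH]; first by rewrite big_ord0 min0n.
  by rewrite big_ord_recr/= IH; case: ltnP; lia.
apply: (@leq_trans (\sum_(1 <= i < n.+1)
    (e + \sum_(k < n + B) (e + k < K i)))%N).
  rewrite big_nat [leqRHS]big_nat; apply: leq_sum => i /andP[i0 iN].
  by apply: layer; have := KB i i0; lia.
rewrite big_split/= sum_nat_const_nat exchange_big/=.
pose f k := (\sum_(1 <= i < n.+1) (e + k < K i))%N.
rewrite -[X in (_ + X)%N]/(\sum_(k < n + B) f k)%N.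
suff /(@sum_geometric_counts f (n + B) n) : forall k,
    (2 ^ k * f k <= n + 2 ^ k)%N by lia.
move=> k; apply: count_spaced => i j ij Ki Kj.
have := spaced i j (e + k).+1 ij Ki Kj.
rewrite expnS expnD mulnCA leq_pmul2l ?expn_gt0//; lia.
Qed.

Section diophantine_product.
Context {R : realType}.
Implicit Types (c d rho a t : R).

Lemma diophantine_nat c d rho (D n : nat) : 0 < c -> d <= D%:R ->
  diophantine c d rho -> (0 < n)%N ->
  c <= dist_int (n%:R * rho) * n%:R ^+ D.
Proof.
move=> c0 dD dio n0; have n1 : 1 <= n%:R :> R by rewrite ler1n.
have nD0 : 0 < n%:R ^+ D :> R by rewrite exprn_gt0// ltr0n.
rewrite -ler_pdivrMr//; apply: le_trans (dio n n0).
rewrite ler_pM2l// powRN lef_pV2 ?posrE ?powR_gt0 ?ltr0n//.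
by rewrite -powR_mulrn ?ler0n// ler_powR.
Qed.

Lemma prod_levels (D n : nat) (u : nat -> R) (K : nat -> nat) :
  (forall i, (0 < i)%N -> 2^-1 ^+ (D * K i) <= u i) ->
  2^-1 ^+ (D * \sum_(1 <= i < n.+1) K i) <= \prod_(1 <= i < n.+1) u i.
Proof.
move=> uK; rewrite big_distrr/= expr_sum big_nat [leRHS]big_nat.
apply: ler_prod => i /andP[i0 _]; rewrite exprn_ge0//=.
exact: uK.
Qed.

(** Backward orbits that approach [0] at most geometrically fast have
    exponentially bounded products of distances, at a rate that depends only on
    the Diophantine constants. *)
Lemma prod_dist_int_lower c d : 0 < c ->
  exists2 q : R, 0 < q & forall rho, diophantine c d rho ->
  forall a, 0 < a -> exists2 b : R, 0 < b &
  forall t, (forall i, (0 < i)%N -> a * 2^-1 ^+ i <= dist_int (t - i%:R * rho)) ->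
  forall n, b * q ^+ n <= \prod_(1 <= i < n.+1) dist_int (t - i%:R * rho).
Proof.
move=> c0.
have half0 : 0 < 2^-1 :> R by rewrite invr_gt0.
have half1 : 2^-1 <= 1 :> R by lra.
have two_pow (x : R) : exists n : nat, x <= 2 ^+ n.
  exists (Num.truncn x).+1; apply/ltW/(lt_le_trans (truncnS_gt _)).
  by rewrite -natrX ler_nat ltnW// ltn_expl.
have small (x : R) : 0 < x -> exists n : nat, 2^-1 ^+ n <= x.
  move=> x0; have [n xn] := two_pow x^-1; exists n.
  by rewrite exprVn -(invrK x) lef_pV2 ?posrE ?invr_gt0 ?exprn_gt0.
pose D := (Num.truncn d).+1.
have dD : d <= D%:R by apply: ltW; exact: truncnS_gt.
have [e0 ce] := two_pow (2 / c).
(* separation constant: visits at level [k] are [2 ^ (k - e)] apart *)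
pose e := e0.+1.
exists (2^-1 ^+ (D * (e + 3))) => [|rho dio a a0]; first by rewrite exprn_gt0.
have [B aB] := small _ a0.
exists (2^-1 ^+ (D * B)) => [|t ta n]; first by rewrite exprn_gt0.
pose u i := dist_int (t - i%:R * rho).
have exK i : exists k : nat, (2^-1 ^+ (D * k) <= u i) || (i == 0%N).
  have [->|i0] := eqVneq i 0%N; first by exists 0%N; rewrite orbT.
  exists (i + B)%N; rewrite -lt0n in i0; apply/orP; left.
  apply: le_trans (ta i i0).
  apply: (@le_trans _ _ (2^-1 ^+ (i + B))).
    by apply: ler_wiXn2l; [exact: ltW| |lia].
  by rewrite exprD mulrC ler_wpM2r// exprn_ge0// ltW.
(* the level [K i] is the least [k] with [2 ^- (D * k) <= u i]; index 0 is
   irrelevant and only made harmless *)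
pose K i := ex_minn (exK i).
have uK i : (0 < i)%N -> 2^-1 ^+ (D * K i) <= u i.
  by rewrite lt0n /K; case: ex_minnP => k /orP[//|/eqP->].
have Ku i k : (k < K i)%N -> u i < 2^-1 ^+ (D * k).
  rewrite /K; case: ex_minnP => m _ mmin km.
  rewrite ltNge; apply/negP => uk.
  by have := mmin k; rewrite uk/= => /(_ isT); lia.
have KB i : (0 < i)%N -> (K i <= i + B)%N.
  move=> i0; rewrite /K; case: ex_minnP => m _; apply.
  apply/orP; left; apply: le_trans (ta i i0).
  apply: (@le_trans _ _ (2^-1 ^+ (i + B))).
    by apply: ler_wiXn2l; [exact: ltW| |lia].
  by rewrite exprD mulrC ler_wpM2r// exprn_ge0// ltW.
have spaced i j k : (0 < i < j)%N -> (k <= K i)%N -> (k <= K j)%N ->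
    (2 ^ k <= 2 ^ e * (j - i))%N.
  move=> /andP[i0 ij]; case: k => [|k] Ki Kj.
    by have : (0 < 2 ^ e)%N; [rewrite expn_gt0|nia].
  have ji0 : (0 < j - i)%N by lia.
  have := diophantine_nat c0 dD dio ji0.
  have -> : (j - i)%:R * rho = (t - i%:R * rho) + - (t - j%:R * rho).
    by rewrite natrB; [ring|exact: ltnW].
  set m := (j - i)%N => cm.
  have cD : c < 2^-1 ^+ (D * k) * 2 * m%:R ^+ D.
    apply: le_lt_trans cm _; rewrite ltr_pM2r ?exprn_gt0 ?ltr0n//.
    apply: le_lt_trans (dist_intD _ _) _; rewrite dist_intN.
    by have := Ku i k Ki; have := Ku j k Kj; rewrite /u; lra.
  have kD : (2 ^ k)%:R ^+ D < 2 / c * m%:R ^+ D.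
    rewrite mulrAC ltr_pdivlMr//.
    move: cD; rewrite -mulrA mulrC exprVn mulrC.
    rewrite [ltRHS]mulrC ltr_pdivlMr ?exprn_gt0//.
    by rewrite natrX -exprM (mulnC k) mulrC.
  rewrite /e !expnS -mulnA leq_mul2l/=.
  rewrite leqNgt; apply/negP => lt.
  move: kD; apply/negP; rewrite -leNgt.
  apply: (@le_trans _ _ ((2 ^ e0 * m)%N%:R ^+ D)); last first.
    by rewrite lerXn2r ?nnegrE ?ler0n// ler_nat ltnW.
  rewrite natrM exprMn ler_wpM2r ?exprn_ge0 ?ler0n// natrX.
  apply: le_trans ce _; rewrite -exprM ler_weXn2l ?ler1n//.
  by rewrite leq_pmulr.
have Ksum := sum_levels n spaced KB.
apply: le_trans (prod_levels n uK).
rewrite -!exprM -exprD; apply: ler_wiXn2l; [exact: ltW|exact: half1|].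
by nia.
Qed.

End diophantine_product.

(** * The fibre maps *)

Section tanh.
Context {R : realType}.
Implicit Types u v : R.

Lemma tanhE u : tanh u = 1 - 2 / (expR (2 * u) + 1).
Proof.
have -> : 2 * u = u + u by ring.
rewrite /tanh expRN expRD.
have u0 := expR_gt0 u; have u2 : 0 < expR u * expR u + 1 by nra.
by field; rewrite ?gt_eqF//= ?addr_gt0 ?invr_gt0.
Qed.

Lemma tanh0 : tanh 0 = 0 :> R.
Proof. by rewrite tanhE mulr0 expR0; field. Qed.

Lemma ler_tanh : {homo @tanh R : u v / u <= v}.
Proof.
move=> u v uv; rewrite !tanhE lerD2l lerN2 ler_pM2l//.
by rewrite lef_pV2 ?posrE ?addr_gt0 ?expR_gt0// lerD2r ler_expR ler_pM2l.
Qed.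

Lemma tanh_ge0 u : 0 <= u -> 0 <= tanh u.
Proof. by move=> u0; rewrite -tanh0 ler_tanh. Qed.

Lemma tanh_le1 u : tanh u <= 1.
Proof.
by rewrite tanhE lerBlDr lerDl divr_ge0// addr_ge0// expR_ge0.
Qed.

Lemma tanh_lower u : 0 <= u -> Num.min u 1 / 2 <= tanh u.
Proof.
move=> u0; apply: (@le_trans _ _ (u / (1 + u))); last first.
  have -> : u / (1 + u) = 1 - 2 / (2 * u + 1 + 1) by field; lra.
  have e0 : 0 < expR (2 * u) + 1 by rewrite addr_gt0// expR_gt0.
  have e1 : 0 < 2 * u + 1 + 1 by lra.
  rewrite tanhE lerD2l lerN2 ler_pM2l// lef_pV2 ?posrE//.
  by rewrite lerD2r addrC expR_ge1Dx.
rewrite ler_pdivlMr; last by lra.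
have [u1|u1] := leP u 1; last by lra.
by have : 0 <= u * (1 - u); [rewrite mulr_ge0 ?subr_ge0|nra].
Qed.

Lemma tanh_lipschitz u v : 0 <= u -> u <= v ->
  tanh v - tanh u <= 4 / (expR (2 * u) + 1) * (v - u).
Proof.
move=> u0 uv; set h := v - u; have h0 : 0 <= h by rewrite subr_ge0.
rewrite !tanhE -(subrK u v) -/h mulrDr expRD.
set x := expR (2 * u); set z := expR (2 * h).
have x0 : 0 < x by exact: expR_gt0.
have z0 : 0 < z by exact: expR_gt0.
have zV : 1 - 2 * h <= z^-1 by rewrite -expRN expR_ge1Dx.
have zh : z * (1 - 2 * h) <= 1.
  by rewrite -ler_pdivlMl// mulr1.
have zx : 0 < z * x + 1 by nra.
rewrite mulrAC ler_pdivlMr; last by nra.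
have -> : (1 - 2 / (z * x + 1) - (1 - 2 / (x + 1))) * (x + 1) =
    2 * (z * x - x) / (z * x + 1) by field; lra.
rewrite ler_pdivrMr//.
by nra.
Qed.

End tanh.

Section sine.
Context {R : realType}.
Implicit Types x y : R.

Let sin_MVT x y : x <= y ->
  exists2 z, z \in `[x, y] & sin y - sin x = cos z * (y - x).
Proof.
move=> xy; apply: (MVT_segment xy).
by apply: continuous_subspaceT => z; exact: continuous_sin.
Qed.

Lemma sin_lipschitz x y : `|sin x - sin y| <= `|x - y|.
Proof.
wlog xy : x y / x <= y => [H|].
  have [xy|yx] := leP x y; first exact: H.
  by rewrite distrC (distrC x); apply: H; exact: ltW.
rewrite distrC [leRHS]distrC; have [z _ ->] := sin_MVT xy.
by rewrite normrM ler_piMl// cos_max.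
Qed.

(** The forcing term, as a function on the line. *)
Definition abs_sin_pi x : R := `|sin (pi * x)|.

Lemma abs_sin_pi_ge0 x : 0 <= abs_sin_pi x.
Proof. exact: normr_ge0. Qed.

Lemma abs_sin_pi_le1 x : abs_sin_pi x <= 1.
Proof. exact: sin_max. Qed.

Lemma abs_sin_pi_lipschitz x y :
  `|abs_sin_pi x - abs_sin_pi y| <= pi * `|x - y|.
Proof.
apply: le_trans (ler_dist_dist _ _) _; apply: le_trans (sin_lipschitz _ _) _.
by rewrite -mulrBr normrM ger0_norm// pi_ge0.
Qed.

Lemma abs_sin_piDz x (m : int) : abs_sin_pi (x + m%:~R) = abs_sin_pi x.
Proof.
have nat_case (n : nat) y : abs_sin_pi (y + n%:R) = abs_sin_pi y.
  elim: n => [|n IH] in y *; first by rewrite addr0.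
  by rewrite -(IH y) /abs_sin_pi -natr1 addrA mulrDr mulr1 sinDpi normrN.
case: m => n; first exact: nat_case.
by rewrite -(nat_case n.+1) NegzE mulrNz subrK.
Qed.

Lemma sin_lower x : 0 <= x <= pi / 2 -> cos 1 / 2 * x <= sin x.
Proof.
move=> /andP[x0 xpi].
have pi1 := pihalf_ge1 R; have pi4 := pihalf_lt2 R.
have c0 := cos1_gt0 R.
have low y : 0 <= y <= 1 -> cos 1 * y <= sin y.
  move=> /andP[y0 y1].
  have [z + sz] := sin_MVT y0.
  rewrite in_itv/= => /andP[z0 zy].
  move: sz; rewrite sin0 !subr0 => ->; apply: ler_wpM2r => //.
  have [->|z1] := eqVneq z 1; first by [].
  by apply: ltW; rewrite ltr_cos ?in_itv/=; lra.
have [x1|x1] := leP x 1; first by have := low x; rewrite x0 x1 => /(_ isT); nra.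
have : cos 1 <= sin x.
  rewrite -cosBpihalf -(cosN (x - _)) opprB; have [->//|ne] := eqVneq (pi / 2 - x) 1.
  by apply: ltW; rewrite ltr_cos ?in_itv/=; lra.
by nra.
Qed.

Lemma abs_sin_pi_lower x : cos 1 * dist_int x <= abs_sin_pi x.
Proof.
pose m := Num.floor x; have /andP[f0 f1] := frac_part_itv x.
set f := x - _ in f0 f1.
have -> : abs_sin_pi x = abs_sin_pi f by rewrite /f -mulrNz abs_sin_piDz.
have pi2 := pi_ge2 R; have c0 := cos1_gt0 R.
have df : dist_int x <= f.
  by apply: le_trans (dist_int_le _ m) _; rewrite ger0_norm.
have d1f : dist_int x <= 1 - f.
  apply: le_trans (dist_int_le _ (m + 1)) _; rewrite intrD opprD addrA -/f.
  by rewrite distrC ger0_norm ?subr_ge0// ltW.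
rewrite /abs_sin_pi; apply: le_trans (ler_norm _).
have low g : 0 <= g -> g <= 2^-1 -> dist_int x <= g ->
    cos 1 * dist_int x <= sin (pi * g).
  move=> g0 gh dg; have := @sin_lower (pi * g).
  rewrite mulr_ge0 ?pi_ge0//= ler_pM2l ?pi_gt0// => /(_ gh); apply: le_trans.
  have -> : cos 1 / 2 * (pi * g) = cos 1 * (pi / 2 * g) :> R by field.
  by rewrite ler_pM2l//; apply: le_trans dg _; nra.
have [fh|fh] := leP f 2^-1; first exact: low.
have -> : sin (pi * f) = sin (pi * (1 - f)).
  by rewrite (mulrBr pi 1 f) mulr1 addrC sinDpi -sinN opprK.
by apply: low => //; lra.
Qed.

End sine.

(** * Lipschitz dependence of the iterated upper boundary lines *)

(** Throughout this section [y j] is the height of an orbit [j] steps before the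
    final time, and [n] is the number of steps. *)
Section recovery.
Context {R : realType}.
Variables (kappa q b : R) (n : nat) (y delta : nat -> R).
Hypotheses (q0 : 0 < q) (q1 : q <= 1) (b0 : 0 < b) (kq : 1 <= kappa * q).
Hypothesis delta0 : forall j, (0 < j)%N -> 0 <= delta j.
Hypothesis prod_delta :
  forall j, b * q ^+ j <= \prod_(1 <= i < j.+1) delta i.
Hypothesis yn : y n = 1.
Hypothesis y_le1 : forall j, (j <= n)%N -> y j <= 1.
Hypothesis recursion : forall j, (j < n)%N ->
  Num.min (kappa * y j.+1) 1 * delta j.+1 <= y j.

Let D j := \prod_(1 <= i < j.+1) delta i.

Let D0 j : 0 < D j.
Proof. by apply: lt_le_trans (prod_delta j); rewrite mulr_gt0// exprn_gt0. Qed.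

Let DS j : D j.+1 = D j * delta j.+1.
Proof. by rewrite /D big_nat_recr. Qed.

Let kappa0 : 0 < kappa.
Proof. by rewrite -(pmulr_lgt0 _ q0) (lt_le_trans ltr01). Qed.

(** In terms of [W j = - ln (y j)], read from [j = n] down to 0, the recursion is
    that of a queue: a step serves [ln kappa] and admits [- ln (delta j)] of
    work.  Since [ln kappa >= - ln q], the workload is controlled by the linear
    bound on the work admitted in total. *)
Lemma recovery_lower j : (j <= n)%N -> b * q ^+ j.+1 <= y j * D j.
Proof.
move=> jn; have -> : j = (n - (n - j))%N by lia.
elim: (n - j)%N => [|k IH].
  rewrite subn0 yn mul1r; apply: le_trans (prod_delta _).
  by rewrite ler_pM2l// exprS ler_piMl// exprn_ge0// ltW.
have [nk|nk] := leqP n k.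
  have -> : (n - k.+1 = n - k)%N by lia.
  exact: IH.
set i := (n - k.+1)%N; have ik : (n - k = i.+1)%N by rewrite /i; lia.
have iN : (i < n)%N by rewrite /i; lia.
rewrite ik in IH.
apply: le_trans (_ : Num.min (kappa * y i.+1) 1 * delta i.+1 * D i <= _).
  rewrite -mulrA (mulrC (delta _)) -DS (minr_pMl _ _ (ltW (D0 _))) mul1r.
  rewrite le_min prod_delta andbT -mulrA.
  apply: le_trans (_ : kappa * (b * q ^+ i.+2) <= _).
    by rewrite (exprS _ i.+1) [leRHS](_ : _ = kappa * q * (b * q ^+ i.+1)); [
      rewrite ler_peMl// mulr_ge0 ?exprn_ge0// ltW | ring].
  by rewrite ler_pM2l.
by apply: ler_wpM2r; [exact: ltW|exact: recursion].
Qed.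

Lemma recovery_gt0 j : (j <= n)%N -> 0 < y j.
Proof.
move=> jn; rewrite -(pmulr_lgt0 _ (D0 j)).
by apply: lt_le_trans (recovery_lower jn); rewrite mulr_gt0// exprn_gt0.
Qed.

(** The truncated inverse heights telescope:
    [min kappa (y i)^-1 * y i * delta i <= y (i - 1)]. *)
Lemma prod_min_inv j : (j <= n)%N ->
  \prod_(1 <= i < j.+1) Num.min kappa (y i)^-1 <= (b * q ^+ j.+1)^-1.
Proof.
move=> jn; set P := fun j => \prod_(1 <= i < j.+1) Num.min kappa (y i)^-1.
have P0 k : (k <= n)%N -> 0 <= P k.
  move=> kn; rewrite /P big_nat; apply: prodr_ge0 => i /andP[_ ik].
  by rewrite le_min ltW//= invr_ge0 ltW// recovery_gt0//; lia.
have telescope k : (k <= n)%N -> P k * (y k * D k) <= y 0%N.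
  elim: k => [_|k IH kn].
    by rewrite /P /D !big_geq// mulr1 mul1r.
  apply: le_trans (IH (ltnW kn)).
  rewrite /P big_nat_recr//= -/(P k) DS -mulrA; apply: ler_wpM2l; first by rewrite P0// ltnW.
  have yk := recovery_gt0 kn.
  rewrite [leLHS](_ : _ =
    (Num.min kappa (y k.+1)^-1 * y k.+1 * delta k.+1) * D k); last by ring.
  apply: ler_wpM2r; [exact: ltW|apply: le_trans (recursion kn)].
  by rewrite (minr_pMl _ _ (ltW yk)) mulVf ?gt_eqF.
have bq0 : 0 < b * q ^+ j.+1 by rewrite mulr_gt0// exprn_gt0.
rewrite -[leRHS]mul1r ler_pdivlMr//.
apply: le_trans (y_le1 (leq0n _)); apply: le_trans (telescope j jn).
by apply: ler_wpM2l; [exact: P0|exact: recovery_lower].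
Qed.

End recovery.

Section contraction.
Context {R : realType}.
Implicit Types (kappa x y : R).

Let tanh_contraction_le kappa x y : 8 <= kappa -> 0 < x -> x <= y -> y <= 1 ->
  `|tanh (kappa * x) - tanh (kappa * y)| <=
  kappa^-1 * Num.min kappa x^-1 ^+ 4 * Num.min kappa y^-1 ^+ 4 * `|x - y|.
Proof.
move=> k8 x0 xy y1; have k0 : 0 < kappa by lra.
have y0 : 0 < y by lra.
have kx0 : 0 <= kappa * x by rewrite mulr_ge0// ltW.
have kxy : kappa * x <= kappa * y by rewrite ler_pM2l.
rewrite distrC ger0_norm ?subr_ge0 ?ler_tanh//.
rewrite distrC ger0_norm ?subr_ge0//.
apply: le_trans (tanh_lipschitz kx0 kxy) _.
rewrite -mulrBr [leLHS]mulrA; apply: ler_wpM2r; first by rewrite subr_ge0.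
have e0 : 0 < expR (2 * (kappa * x)) + 1 by rewrite addr_gt0// expR_gt0.
have my1 : 1 <= Num.min kappa y^-1.
  by rewrite le_min invf_ge1// y1 andbT; lra.
apply: (@le_trans _ _ (kappa^-1 * Num.min kappa x^-1 ^+ 4)); last first.
  rewrite ler_peMr ?exprn_ege1// mulr_ge0 ?invr_ge0 ?ltW// exprn_gt0//.
  by rewrite lt_min k0 invr_gt0.
rewrite mulrAC ler_pdivrMr// -[leRHS]mulrA ler_pdivlMl//.
have -> : kappa * (4 * kappa) = 4 * kappa ^+ 2 by ring.
have k64 : 64 <= kappa ^+ 2 by rewrite expr2; nra.
have k4 : kappa ^+ 4 = kappa ^+ 2 * kappa ^+ 2 by ring.
have [kx|kx] := leP kappa x^-1.
  have : 1 <= expR (2 * (kappa * x)).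
    by rewrite -(expR0 R) ler_expR mulr_ge0.
  rewrite k4; move: (kappa ^+ 2) k64 (expR _) => k2 k64 e e1.
  have : 0 <= k2 * (k2 - 4) by rewrite mulr_ge0//; lra.
  have : 0 <= k2 * k2 * e by rewrite !mulr_ge0//; lra.
  by lra.
rewrite exprVn ler_pdivlMl ?exprn_gt0//.
have : (2 * (kappa * x)) ^+ 4 / 24 <= expR (2 * (kappa * x)).
  have u0 : 0 <= 2 * (kappa * x) by rewrite mulr_ge0.
  by have := expR_ge1Dxn 3 u0; rewrite (_ : 4`!%:R = 24 :> R)//; lra.
move: (expR _) => e; rewrite !exprMn k4.
rewrite (_ : 2 ^+ 4 = 16); last by ring.
have : 0 <= x ^+ 4 by rewrite exprn_ge0// ltW.
move: (kappa ^+ 2) k64 (x ^+ 4) => k2 k64 x4 x40 ex4.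
have : 0 <= k2 * x4 * (k2 - 6) by rewrite !mulr_ge0//; lra.
by lra.
Qed.

(** Away from the zero line the fibre maps contract strongly; near it, the
    expansion is paid for by a power of the (truncated) inverse height. *)
Lemma tanh_contraction kappa x y : 8 <= kappa -> 0 < x <= 1 -> 0 < y <= 1 ->
  `|tanh (kappa * x) - tanh (kappa * y)| <=
  kappa^-1 * Num.min kappa x^-1 ^+ 4 * Num.min kappa y^-1 ^+ 4 * `|x - y|.
Proof.
move=> k8 /andP[x0 x1] /andP[y0 y1]; have [xy|/ltW yx] := leP x y.
  exact: tanh_contraction_le.
rewrite distrC (distrC x) (mulrAC kappa^-1); exact: tanh_contraction_le.
Qed.

End contraction.

Section pullback.
Context {R : realType}.
Variables (kappa rho : R).
Implicit Types (t x : R) (n : nat).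

(** The second coordinate of the [n]-th iterate of the skew product that starts
    at height [x] and ends on the fibre over [t], read on the real line. *)
Fixpoint pullback n t x : R :=
  if n is n'.+1 then
    tanh (kappa * pullback n' (t - rho) x) * abs_sin_pi (t - rho)
  else x.

Hypothesis kappa0 : 0 < kappa.

Lemma pullback_unit n t x : 0 <= x <= 1 -> 0 <= pullback n t x <= 1.
Proof.
move=> x01; elim: n t => [//|n IH] t /=; have /andP[p0 p1] := IH (t - rho).
have t0 : 0 <= tanh (kappa * pullback n (t - rho) x).
  by rewrite tanh_ge0// mulr_ge0// ltW.
rewrite mulr_ge0 ?abs_sin_pi_ge0//=.
by rewrite mulr_ile1 ?abs_sin_pi_ge0 ?tanh_le1 ?abs_sin_pi_le1.
Qed.

Lemma pullback_homo n t : {homo pullback n t : x y / x <= y}.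
Proof.
move=> x y xy; elim: n t => [//|n IH] t /=.
by rewrite ler_wpM2r ?abs_sin_pi_ge0// ler_tanh// ler_pM2l.
Qed.

Lemma pullback0 n t : pullback n t 0 = 0.
Proof. by elim: n t => [//|n IH] t /=; rewrite IH mulr0 tanh0 mul0r. Qed.

Lemma pullbackDz n t (m : int) x : pullback n (t + m%:~R) x = pullback n t x.
Proof.
elim: n t => [//|n IH] t /=.
by rewrite (_ : t + m%:~R - rho = t - rho + m%:~R) ?IH ?abs_sin_piDz//; ring.
Qed.

(* the height over [t - j * rho], on the way from height 1 to the fibre of [t] *)
Let sample n t j := pullback (n - j) (t - j%:R * rho) 1.

Let sample_unit n t j : 0 <= sample n t j <= 1.
Proof. by apply: pullback_unit; rewrite ler01 lexx. Qed.

Let sampleE n t j : (j < n)%N ->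
  sample n t j = tanh (kappa * sample n t j.+1) * abs_sin_pi (t - j.+1%:R * rho).
Proof.
move=> jn; rewrite /sample -subnSK//=.
by rewrite (_ : t - j%:R * rho - rho = t - j.+1%:R * rho)// -natr1; ring.
Qed.

(** The backward orbit of [t] approaches the zero of the forcing term so slowly
    that the products of the forcing terms decay at most at rate [q]. *)
Definition slow_approach (b q t : R) := forall j,
  b * q ^+ j <= \prod_(1 <= i < j.+1) (abs_sin_pi (t - i%:R * rho) / 2).

Variables (b q : R).
Hypotheses (b0 : 0 < b) (q0 : 0 < q) (q1 : q <= 1).
Hypotheses (k8 : 8 <= kappa) (kq : 2 <= kappa * q ^+ 8).

Let kq1 : 1 <= kappa * q.
Proof.
apply: (@le_trans _ _ (kappa * q ^+ 8)).
  by apply: le_trans kq; rewrite ler1n.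
by rewrite ler_pM2l// exprS ler_piMr ?exprn_ile1// ltW.
Qed.

Let sample_recursion n t j : (j < n)%N ->
  Num.min (kappa * sample n t j.+1) 1 * (abs_sin_pi (t - j.+1%:R * rho) / 2) <=
  sample n t j.
Proof.
move=> jn; rewrite (sampleE t jn) mulrA mulrAC ler_wpM2r ?abs_sin_pi_ge0//.
apply: tanh_lower; apply: mulr_ge0; first exact: ltW.
by have /andP[] := sample_unit n t j.+1.
Qed.

Let half_abs_sin_ge0 t j : 0 <= abs_sin_pi (t - j%:R * rho) / 2.
Proof. by rewrite divr_ge0// abs_sin_pi_ge0. Qed.

Let sample_le1 n t j : sample n t j <= 1.
Proof. by have /andP[] := sample_unit n t j. Qed.

Let sample_n n t : sample n t n = 1.
Proof. by rewrite /sample subnn. Qed.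

Let sample_gt0 n t j : slow_approach b q t -> (j <= n)%N -> 0 < sample n t j.
Proof.
move=> st jn.
apply: (@recovery_gt0 _ kappa q b n (sample n t)
  (fun j => abs_sin_pi (t - j%:R * rho) / 2)) => //.
exact: sample_recursion.
Qed.

Let sample_prod n t j : slow_approach b q t -> (j <= n)%N ->
  \prod_(1 <= i < j.+1) Num.min kappa (sample n t i)^-1 <= (b * q ^+ j.+1)^-1.
Proof.
move=> st jn.
apply: (@prod_min_inv _ kappa q b n (sample n t)
  (fun j => abs_sin_pi (t - j%:R * rho) / 2)) => //.
exact: sample_recursion.
Qed.

(** The contraction factors along the two orbits multiply to at most
    [(b * q) ^- 8 * 2 ^- j], so the errors made at each step are summable. *)
Lemma pullback1_lipschitz n t u : slow_approach b q t -> slow_approach b q u ->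
  `|pullback n t 1 - pullback n u 1| <= 2 * pi * (b * q) ^- 8 * `|t - u|.
Proof.
move=> st su.
pose c i := kappa^-1 * Num.min kappa (sample n t i)^-1 ^+ 4 *
  Num.min kappa (sample n u i)^-1 ^+ 4.
pose P j := \prod_(1 <= i < j.+1) c i.
pose e j := `|sample n t j - sample n u j|.
have mt0 i : (i <= n)%N -> 0 <= Num.min kappa (sample n t i)^-1.
  by move=> iN; rewrite le_min ltW//= invr_ge0 ltW// sample_gt0.
have mu0 i : (i <= n)%N -> 0 <= Num.min kappa (sample n u i)^-1.
  by move=> iN; rewrite le_min ltW//= invr_ge0 ltW// sample_gt0.
have c0 i : (i <= n)%N -> 0 <= c i.
  by move=> iN; rewrite /c !mulr_ge0 ?exprn_ge0 ?mt0 ?mu0// invr_ge0 ltW.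
have P0 j : (j <= n)%N -> 0 <= P j.
  move=> jn; rewrite /P big_nat; apply: prodr_ge0 => i /andP[_ ij].
  by apply: c0; lia.
have step j : (j < n)%N -> e j <= c j.+1 * e j.+1 + pi * `|t - u|.
  move=> jn; rewrite /e (sampleE t jn) (sampleE u jn).
  set A := tanh _; set B := tanh _; set S := abs_sin_pi _; set T := abs_sin_pi _.
  have -> : A * S - B * T = (A - B) * S + B * (S - T) by ring.
  apply: le_trans (ler_normD _ _) _; rewrite (normrM (A - B)) (normrM B); apply: lerD.
    apply: (@le_trans _ _ `|A - B|).
      by rewrite ler_piMr// ger0_norm ?abs_sin_pi_ge0 ?abs_sin_pi_le1.
    by apply: tanh_contraction => //; rewrite sample_gt0//= sample_le1.
  apply: (@le_trans _ _ `|S - T|).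
    have B0 : 0 <= B.
      by rewrite tanh_ge0// mulr_ge0 ?(ltW kappa0)//; have /andP[] := sample_unit n u j.+1.
    by apply: ler_piMl; [exact: normr_ge0|rewrite (ger0_norm B0); exact: tanh_le1].
  apply: le_trans (abs_sin_pi_lipschitz _ _) _.
  by rewrite (_ : t - _ - _ = t - u)//; ring.
have unroll j : (j <= n)%N ->
    e 0%N <= P j * e j + pi * `|t - u| * \sum_(i < j) P i.
  elim: j => [_|j IH jn].
    by rewrite /P big_geq// mul1r big_ord0 mulr0 addr0.
  apply: le_trans (IH (ltnW jn)) _.
  rewrite big_ord_recr/= mulrDr.
  rewrite (_ : P j.+1 = P j * c j.+1); last by rewrite /P big_nat_recr.
  have := ler_wpM2l (P0 j (ltnW jn)) (step j jn).
  by rewrite mulrDr mulrA (mulrC (P j) (pi * _)); lra.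
have bq0 : 0 < b * q by rewrite mulr_gt0.
have PE j : (j <= n)%N -> P j <= (b * q) ^- 8 * 2^-1 ^+ j.
  move=> jn; rewrite /P /c 2!big_split/= !prodrXl prodr_const_nat subn1/=.
  apply: (@le_trans _ _ (kappa^-1 ^+ j * (b * q ^+ j.+1)^-1 ^+ 4 *
      (b * q ^+ j.+1)^-1 ^+ 4)).
    have prod0 v : slow_approach b q v ->
        0 <= \prod_(1 <= i < j.+1) Num.min kappa (sample n v i)^-1.
      move=> sv; rewrite big_nat; apply: prodr_ge0 => i /andP[_ ij].
      by rewrite le_min ltW//= invr_ge0 ltW// sample_gt0//; lia.
    have bound v : slow_approach b q v ->
        (\prod_(1 <= i < j.+1) Num.min kappa (sample n v i)^-1) ^+ 4 <=
        (b * q ^+ j.+1)^-1 ^+ 4.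
      move=> sv; rewrite lerXn2r ?nnegrE ?prod0// ?sample_prod//.
      by rewrite invr_ge0 mulr_ge0 ?exprn_ge0// ltW.
    have k0 : 0 <= kappa^-1 ^+ j by rewrite exprn_ge0// invr_ge0 ltW.
    apply: ler_pM; [|by apply: exprn_ge0; exact: prod0| |exact: bound].
      by apply: mulr_ge0 => //; apply: exprn_ge0; exact: prod0.
    by apply: ler_wpM2l => //; exact: bound.
  have kq8 : (kappa * q ^+ 8)^-1 <= 2^-1.
    by rewrite lef_pV2 ?posrE// mulr_gt0// exprn_gt0.
  apply: (@le_trans _ _ ((b * q) ^- 8 * (kappa * q ^+ 8)^-1 ^+ j)).
    rewrite le_eqVlt; apply/orP; left; apply/eqP.
    rewrite !exprVn (exprMn _ kappa) (exprS q j) (exprAC q 8 j).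
    have : kappa ^+ j != 0 by rewrite expf_neq0// gt_eqF.
    have : q ^+ j != 0 by rewrite expf_neq0// gt_eqF.
    have b1 : b != 0 by rewrite gt_eqF.
    have q2 : q != 0 by rewrite gt_eqF.
    by move: (q ^+ j) (kappa ^+ j) => X K X0 K0; field; rewrite X0 K0 b1 q2.
  apply: ler_wpM2l; first by rewrite invr_ge0 exprn_ge0// ltW.
  by rewrite lerXn2r// nnegrE ?invr_ge0// ltW// mulr_gt0// exprn_gt0.
have sum2 : \sum_(i < n) P i <= (b * q) ^- 8 * 2.
  apply: (@le_trans _ _ (\sum_(i < n) (b * q) ^- 8 * 2^-1 ^+ i)).
    by apply: ler_sum => i _; apply: PE; exact: ltnW.
  rewrite -mulr_sumr ler_pM2l ?invr_gt0 ?exprn_gt0//.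
  suff -> : \sum_(i < n) 2^-1 ^+ i = 2 - 2 * 2^-1 ^+ n :> R.
    by rewrite lerBlDr lerDl mulr_ge0// exprn_ge0.
  elim: (n) => [|k IH]; first by rewrite big_ord0 expr0; ring.
  by rewrite big_ord_recr/= IH exprS; field.
have en : e n = 0 by rewrite /e !sample_n subrr normr0.
have e0 : e 0%N = `|pullback n t 1 - pullback n u 1|.
  by rewrite /e /sample subn0 !mul0r !subr0.
have := unroll n (leqnn _); rewrite en e0 mulr0 add0r => /le_trans; apply.
rewrite (_ : 2 * pi * (b * q) ^- 8 * `|t - u| =
  pi * `|t - u| * ((b * q) ^- 8 * 2)); last by ring.
by rewrite ler_wpM2l// mulr_ge0 ?pi_ge0.
Qed.

End pullback.

(** * The upper bounding graph as an infimum of boundary lines *)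

Section circle_lemmas.
Context {R : realType}.
Implicit Types (x : R) (s : circle R).

Lemma to_circle_val s : to_circle (circle_val s) = s.
Proof.
apply/val_inj => /=; rewrite (@Num.Theory.floor_def _ _ 0) ?subr0//.
by rewrite add0r; exact: circle_valP.
Qed.

Lemma to_circle_id x : 0 <= x < 1 -> circle_val (to_circle x) = x.
Proof.
by move=> x01 /=; rewrite (@Num.Theory.floor_def _ _ 0) ?subr0// add0r.
Qed.

Lemma to_circleDz x (m : int) : to_circle (x + m%:~R) = to_circle x.
Proof.
apply/val_inj => /=; rewrite floorDrz ?intr_int// intrD (floorK (intr_int _ m)).
by rewrite opprD addrACA subrr addr0.
Qed.

Lemma circle_val_to_circle x :
  exists m : int, circle_val (to_circle x) = x + m%:~R.
Proof. by exists (- Num.floor x); rewrite mulrNz. Qed.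

Lemma sin_circle_val s : sin (pi * circle_val s) = abs_sin_pi (circle_val s).
Proof.
have /andP[s0 s1] := circle_valP s.
rewrite /abs_sin_pi ger0_norm// sin_ge0_pi// mulr_ge0 ?pi_ge0//=.
by rewrite ler_piMr ?pi_ge0// ltW.
Qed.

Lemma continuous_tanh : continuous (@tanh R).
Proof.
rewrite (_ : tanh = fun u => 1 - 2 * (expR (2 * u) + 1)^-1); last first.
  by apply/funext => u; rewrite tanhE.
move=> u; apply: cvgB; first exact: cvg_cst.
apply: cvgM; first exact: cvg_cst.
apply: cvgV; first by rewrite gt_eqF// addr_gt0// expR_gt0.
apply: cvgD; last exact: cvg_cst.
apply: (@continuous_comp _ _ _ (fun u : R => 2 * u) expR).
  exact: mulrl_continuous.
exact: continuous_expR.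
Qed.

Lemma continuous_abs_sin_pi : continuous (@abs_sin_pi R).
Proof.
move=> x; apply: (@continuous_comp _ _ _ (fun x : R => sin (pi * x)) Num.norm).
  apply: (@continuous_comp _ _ _ (fun x : R => pi * x) sin).
    exact: mulrl_continuous.
  exact: continuous_sin.
exact: norm_continuous.
Qed.

End circle_lemmas.

Section attractor.
Context {R : realType}.
Variables (rho : R) (kappa : {posnum R}).
Implicit Types (n : nat) (t x : R).

Local Notation pullback := (pullback kappa%:num rho).
Local Notation F := (skew_map rho kappa).

Lemma continuous_pullback n t : continuous (pullback n t).
Proof.
elim: n t => [|n IH] t x /=; first exact: cvg_id.
apply: cvgM; last exact: cvg_cst.
apply: (@continuous_comp _ _ _ (fun x => kappa%:num * pullback n (t - rho) x)
  tanh); last exact: continuous_tanh.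
by apply: cvgM; [exact: cvg_cst|exact: IH].
Qed.

Lemma continuous_pullback_fibre n x : continuous (fun t => pullback n t x).
Proof.
elim: n => [|n IH] t /=; first exact: cvg_cst.
have cB : (fun t => t - rho) @ t --> t - rho.
  by apply: cvgB; [exact: cvg_id|exact: cvg_cst].
apply: cvgM; last first.
  apply: (@continuous_comp _ _ _ (fun t => t - rho) abs_sin_pi) => //.
  exact: continuous_abs_sin_pi.
apply: (@continuous_comp _ _ _
  (fun t => kappa%:num * pullback n (t - rho) x) tanh).
  apply: cvgM; first exact: cvg_cst.
  by apply: (@continuous_comp _ _ _ (fun t => t - rho)
    (fun t => pullback n t x)) => //; exact: IH.
exact: continuous_tanh.
Qed.

Lemma iter_skew_map_fst n p :
  (iter n F p).1 = to_circle (circle_val p.1 + n%:R * rho).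
Proof.
elim: n => [|n IH]; first by rewrite mul0r addr0 to_circle_val.
rewrite iterS [LHS]/= IH -natr1.
have [m ->] := circle_val_to_circle (circle_val p.1 + n%:R * rho).
rewrite -(to_circleDz _ (- m)) mulrNz; congr to_circle; ring.
Qed.

Lemma iter_skew_map_snd n p : \val (iter n F p).2 =
  pullback n (circle_val p.1 + n%:R * rho) (\val p.2).
Proof.
elim: n => [//|n IH].
rewrite iterS [LHS]/= /fibre_map sin_circle_val iter_skew_map_fst.
have [m ->] := circle_val_to_circle (circle_val p.1 + n%:R * rho).
rewrite abs_sin_piDz IH/=.
by rewrite (_ : circle_val p.1 + n.+1%:R * rho - rho =
  circle_val p.1 + n%:R * rho)//; ring.
Qed.

(** The upper bounding graph, as a function on the line. *)
Definition upper_line t : R := inf (range (fun n => pullback n t 1)).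

Let unit1 : 0 <= (1 : R) <= 1. Proof. by rewrite ler01 lexx. Qed.

Let lbound_range t : lbound (range (fun n => pullback n t 1)) 0.
Proof.
move=> _ [n _ <-].
by have /andP[] := pullback_unit rho [gt0 of kappa%:num] n t unit1.
Qed.

Let range_n0 t : range (fun n => pullback n t 1) !=set0.
Proof. by exists (pullback 0 t 1), 0%N. Qed.

Lemma upper_line_ge0 t : 0 <= upper_line t.
Proof. by apply: lb_le_inf; [exact: range_n0|exact: lbound_range]. Qed.

Lemma upper_line_le n t : upper_line t <= pullback n t 1.
Proof. by apply: ge_inf; [exists 0; exact: lbound_range|exists n]. Qed.

Lemma upper_line_le1 t : upper_line t <= 1.
Proof. exact: (upper_line_le 0). Qed.

Lemma upper_line_near t e : 0 < e ->
  exists n, pullback n t 1 < upper_line t + e.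
Proof.
move=> e0; have [] := @inf_adherent _ (range (fun n => pullback n t 1)) e e0.
  by split; [exact: range_n0|exists 0; exact: lbound_range].
by move=> _ [n _ <-] ?; exists n.
Qed.

Lemma global_attractor_le theta (x : unit_interval R) :
  global_attractor rho kappa (theta, x) ->
  \val x <= upper_line (circle_val theta).
Proof.
move=> Ax; apply: lb_le_inf => // _ [n _ <-].
have [p _ Fp] := Ax n I.
have -> : \val x = \val (iter n F p).2 by rewrite Fp.
have [m tm] := circle_val_to_circle (circle_val p.1 + n%:R * rho).
rewrite -iter_skew_map_fst Fp/= in tm.
rewrite iter_skew_map_snd tm pullbackDz; apply: pullback_homo => //.
by case: p.2 => z /=; rewrite inE/= in_itv/= => /andP[].
Qed.

Lemma upper_line_attractor theta (x : unit_interval R) :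
  \val x = upper_line (circle_val theta) ->
  global_attractor rho kappa (theta, x).
Proof.
move=> xE n _; set t := circle_val theta.
have [z zI zE] : exists2 z, z \in `[0, 1] & pullback n t z = upper_line t.
  apply: IVT => //.
    by apply: continuous_subspaceT => z; exact: continuous_pullback.
  have := upper_line_le n t; have := upper_line_ge0 t.
  rewrite pullback0 => u0 un; have u1 := le_trans u0 un.
  by rewrite ge_min u0/= le_max un orbT.
have zI' : z \in (`[0, 1]%classic : set R) by rewrite inE.
exists (to_circle (t - n%:R * rho), exist _ z zI') => //.
rewrite [iter _ _ _]surjective_pairing; congr (_, _).
  rewrite iter_skew_map_fst.
  have [m /= ->] := circle_val_to_circle (t - n%:R * rho).
  rewrite -[RHS]to_circle_val -/t -(to_circleDz t m); congr to_circle; ring.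
apply/val_inj; rewrite iter_skew_map_snd xE -zE.
have [m -> /=] := circle_val_to_circle (t - n%:R * rho).
by rewrite addrAC pullbackDz subrK.
Qed.

Lemma upper_graph_funE theta :
  \val (upper_graph_fun rho kappa theta) = upper_line (circle_val theta).
Proof.
set t := circle_val theta.
have uI : upper_line t \in (`[0, 1]%classic : set R).
  by rewrite inE/= in_itv/= upper_line_ge0 upper_line_le1.
have uA : attractor_fibre rho kappa theta (upper_line t).
  pose x : unit_interval R := exist _ (upper_line t) uI.
  by exists x => //; exact: upper_line_attractor.
have ub : ubound (attractor_fibre rho kappa theta) (upper_line t).
  by move=> _ [x /= Ax <-]; exact: global_attractor_le.
apply/eqP; rewrite eq_le /=; apply/andP; split.
  by apply: ge_sup => //; exists (upper_line t).
by apply: ub_le_sup => //; exists (upper_line t).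
Qed.

Lemma measurable_upper_line : measurable_fun [set: R] upper_line.
Proof.
have -> : upper_line = (fun t => infs (fun n => pullback n t 1) 0).
  by apply/funext => t; rewrite /upper_line /infs/=; congr inf;
     apply/seteqP; split => _ [n _ <-]; exists n.
apply: measurable_fun_infs.
  by move=> t _; exists 0; exact: lbound_range.
move=> n; apply: continuous_measurable_fun; exact: continuous_pullback_fibre.
Qed.

(** The bound is uniform in the number of iterations, hence passes to the limit. *)
Lemma upper_line_lipschitz (L t u : R) :
  (forall n, `|pullback n t 1 - pullback n u 1| <= L * `|t - u|) ->
  `|upper_line t - upper_line u| <= L * `|t - u|.
Proof.
have half v w : (forall n, pullback n v 1 - pullback n w 1 <= L * `|t - u|) ->
    upper_line v - upper_line w <= L * `|t - u|.
  move=> vw; apply/ler_addgt0Pr => e e0.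
  have [n ne] := upper_line_near w e0.
  by have := upper_line_le n v; have := vw n; lra.
move=> tu; rewrite ler_norml; apply/andP; split; last first.
  by apply: half => n; apply: le_trans (ler_norm _) (tu n).
rewrite lerNl opprB; apply: half => n.
by rewrite -opprB; apply: le_trans (tu n); rewrite -normrN ler_norm.
Qed.

End attractor.

(** * Entropy of a partition *)

(** The part of [E] where [n * u] has integral part [k]. *)
Definition strip (T : Type) (R : realType) (E : set T) (u : T -> R) (n k : nat) :=
  E `&` [set t | k%:R <= n%:R * u t < k.+1%:R].

Section entropy.
Local Open Scope ereal_scope.
Context d (T : measurableType d) (R : realType).
Variables (nu : {measure set T -> \bar R}) (h : T -> \bar R).
Hypothesis mh : measurable_fun [set: T] h.
Hypothesis h0 : forall t, 0 <= h t.

(** On a set of mass [p], the integral of [- ln p] is at most [w - p * ln w],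
    whatever the guess [w] at the mass. *)
Lemma integral_cell (E : set T) (p w : R) : measurable E -> nu E = p%:E ->
  (0 < w)%R -> (forall t, E t -> h t <= - lne p%:E) ->
  \int[nu]_(t in E) h t <= w%:E + (- ln w)%:E * nu E.
Proof.
move=> mE nuE w0 hE.
have p0 : (0 <= p)%R by rewrite -lee_fin -nuE.
move: p0; rewrite le_eqVlt => /orP[/eqP p0|p0].
  rewrite null_set_integral//; last 2 first.
  - exact: measurable_funS mh.
  - by rewrite nuE -p0.
  by rewrite nuE -p0 mule0 adde0 lee_fin ltW.
apply: (@le_trans _ _ (\int[nu]_(t in E) cst (- ln p)%:E t)).
  apply: ge0_le_integral => //.
  - exact: measurable_funS mh.
  - by move=> t Et; have := hE t Et; rewrite lne_EFin.
rewrite integral_cst// nuE -!EFinM -EFinD lee_fin.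
have : (ln (w / p) <= w / p - 1)%R.
  have wp : (0 < w / p)%R by rewrite divr_gt0.
  have := @le_ln1Dx R (w / p - 1)%R.
  by rewrite (addrC 1%R) subrK; apply; lra.
rewrite ln_div ?posrE// => H.
have := ler_wpM2l (ltW p0) H.
by rewrite !mulrBr mulr1 mulrCA mulfV ?gt_eqF// mulr1; lra.
Qed.

(** The bound of [integral_cell] adds up over the level strips of [u]. *)
Lemma integral_strips (E : set T) (u : T -> R) (n : nat) (w M : R) :
  measurable E -> measurable_fun [set: T] u ->
  (forall t, E t -> (0 <= u t <= 1)%R) -> (0 < n)%N ->
  (forall k, \int[nu]_(t in strip E u n k) h t <=
    w%:E + M%:E * nu (strip E u n k)) ->
  \int[nu]_(t in E) h t <= (n.+1%:R * w)%:E + M%:E * nu E.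
Proof.
move=> mE mu u01 n0 stripP.
have mL (a : R) : measurable (E `&` [set t | (n%:R * u t < a)%R]).
  apply: measurableI => //; rewrite -[X in measurable X]setTI.
  have mnu : measurable_fun [set: T] (fun t => n%:R * u t)%R.
    exact: measurable_funM.
  rewrite (_ : [set t | _] = (fun t => n%:R * u t)%R @^-1` `]-oo, a[%classic).
    by apply: mnu => //; exact: measurable_itv.
  by apply/seteqP; split => t /=; rewrite in_itv.
have mG (a : R) : measurable (E `&` [set t | (a <= n%:R * u t)%R]).
  rewrite (_ : _ `&` _ = E `\` (E `&` [set t | (n%:R * u t < a)%R])).
    exact: measurableD.
  apply/seteqP; split => t /=.
    by move=> [Et at']; split => // -[_]; rewrite ltNge at'.
  by move=> [Et]; rewrite leNgt => na; split => //; apply/negP => ?; apply: na.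
pose L (m : nat) := E `&` [set t | (n%:R * u t < m%:R)%R].
suff /(_ n.+1) : forall m,
    \int[nu]_(t in L m) h t <= (m%:R * w)%:E + M%:E * nu (L m).
  rewrite (_ : L n.+1 = E)//; apply/seteqP; split => t /=; first by case.
  move=> Et; split => //=; have /andP[_ u1] := u01 t Et.
  apply: (@le_lt_trans _ _ n%:R); last by rewrite ltr_nat.
  by rewrite ler_piMr.
elim=> [|m IH].
  rewrite (_ : L 0%N = set0) ?integral_set0 ?measure0 ?mule0 ?mul0r ?adde0//.
  apply/seteqP; split => t //= -[Et]/=; have /andP[u0 _] := u01 t Et.
  by rewrite ltNge mulr_ge0.
pose C := strip E u n m.
have mC : measurable C.
  rewrite (_ : C = (E `&` [set t | (m%:R <= n%:R * u t)%R]) `&`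
                   (E `&` [set t | (n%:R * u t < m.+1%:R)%R])).
    exact: measurableI.
  apply/seteqP; split => t /=; first by move=> [Et /andP[]].
  by move=> [[Et le] [_ lt]]; split => //; apply/andP.
have LC : [disjoint L m & C].
  rewrite disj_set2E; apply/eqP/seteqP; split => t //=.
  by move=> [[_ /= lt] [_ /andP[]]]; rewrite leNgt lt.
have LE : L m.+1 = L m `|` C.
  apply/seteqP; split => t /=.
    move=> [Et /= lt]; have [ltm|lem] := ltP (n%:R * u t)%R m%:R; first by left.
    by right; split => //=; rewrite lem.
  move=> [[Et /= lt]|[Et /andP[_ lt]]]; split => //=.
  by apply: lt_le_trans lt _; rewrite ler_nat.
rewrite LE (ge0_integral_setU _ (mL _) mC)//; last exact: measurable_funS mh.
rewrite measureU//; [|exact: mL|by apply/eqP; rewrite -disj_set2E].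
rewrite ge0_muleDr// -natr1 mulrDl mul1r EFinD.
by rewrite [leRHS]addeACA; apply: leeD; [exact: IH|exact: stripP].
Qed.

End entropy.

(** * The graph measure as a push-forward of Lebesgue measure *)

Section dist_int_measure.
Context {R : realType}.
Implicit Types x y t r : R.

Lemma dist_intDz x (m : int) : dist_int (x + m%:~R) = dist_int x.
Proof.
have le y (k : int) : dist_int (y + k%:~R) <= dist_int y.
  apply: le_dist_int => j; apply: le_trans (dist_int_le _ (j + k)) _.
  by rewrite intrD (_ : y + k%:~R - _ = y - j%:~R)//; ring.
apply/eqP; rewrite eq_le le/=.
by have := le (x + m%:~R) (- m); rewrite mulrNz addrK.
Qed.

Lemma dist_int_le_norm x : dist_int x <= `|x|.
Proof. by have := dist_int_le x 0; rewrite mulr0z subr0. Qed.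

Lemma dist_int_ltP x r : dist_int x < r -> exists m : int, `|x - m%:~R| < r.
Proof.
move=> xr; apply: contrapT => /forallNP nex.
move: xr; apply/negP; rewrite -leNgt; apply: le_dist_int => m.
by rewrite leNgt; apply/negP; exact: nex.
Qed.

Lemma continuous_dist_int : continuous (@dist_int R).
Proof.
have le x y : dist_int x - dist_int y <= `|x - y|.
  rewrite lerBlDl -[in leLHS](subrKC y x).
  apply: le_trans (dist_intD _ _) _.
  by rewrite lerD2l dist_int_le_norm.
move=> x; apply/cvgrPdist_lt => e e0; near=> y.
apply: (@le_lt_trans _ _ `|x - y|).
  by rewrite ler_norml lerNl opprB le distrC le.
by near: y; exact: cvgr_dist_lt.
Unshelve. all: by end_near. Qed.

(** The reals that are within [r] of [y] modulo 1. *)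
Definition arc y r : set R := [set t | dist_int (t - y) < r].

Lemma measurable_arc y r : measurable (arc y r).
Proof.
have mf : measurable_fun [set: R] (fun t => dist_int (t - y)).
  apply: continuous_measurable_fun => t.
  apply: (@continuous_comp _ _ _ (fun t : R => t - y) dist_int).
    by apply: cvgB; [exact: cvg_id|exact: cvg_cst].
  exact: continuous_dist_int.
rewrite (_ : arc y r =
  [set: R] `&` (fun t => dist_int (t - y)) @^-1` `]-oo, r[%classic).
  by apply: mf => //; exact: measurable_itv.
by rewrite setTI; apply/seteqP; split => t /=; rewrite in_itv.
Qed.

(** Lebesgue measure on [0, 1), as a measure on the line. *)
Definition unit_lebesgue : {measure set (measurableTypeR R) -> \bar R} :=
  mrestr lebesgue_measure (measurable_itv `[(0 : R), 1[).

Lemma unit_lebesgueE (A : set R) :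
  unit_lebesgue A = lebesgue_measure (A `&` `[0, 1[).
Proof. by []. Qed.

Lemma unit_lebesgueT : unit_lebesgue [set: R] = 1%E.
Proof. by rewrite unit_lebesgueE setTI lebesgue_measure_itv/= lte_fin ltr01 oppr0 adde0. Qed.

Lemma unit_lebesgue_le1 (A : set R) : measurable A -> (unit_lebesgue A <= 1)%E.
Proof. by move=> mA; rewrite -unit_lebesgueT le_measure ?inE. Qed.

Lemma unit_lebesgue_fin (A : set R) : measurable A ->
  unit_lebesgue A = (fine (unit_lebesgue A))%:E.
Proof.
move=> mA; rewrite fineK// ge0_fin_numE//.
by apply: le_lt_trans (unit_lebesgue_le1 mA) _; rewrite ltry.
Qed.

(** The constant 6 is not optimal: it comes from three translates of an
    interval of length [2 * r]. *)
Lemma unit_lebesgue_arc y r : 0 < r ->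
  (unit_lebesgue (arc y r) <= (6 * r)%:E)%E.
Proof.
move=> r0; have mD := measurable_arc y r.
have [r6|r6] := leP 1 (6 * r).
  by apply: le_trans (unit_lebesgue_le1 mD) _; rewrite lee_fin.
have [m ym] := circle_val_to_circle y.
have := circle_valP (to_circle y); set z := circle_val _ in ym * => z01.
have mB (k : R) : measurable (ball k r) by exact: measurable_ball.
have lB k : (lebesgue_measure (ball k r) <= (r *+ 2)%:E)%E.
  by rewrite lebesgue_measure_ball// ltW.
have mU2 : measurable (ball z r `|` ball (z + 1) r) by exact: measurableU.
have mU3 : measurable (ball (z - 1) r `|` (ball z r `|` ball (z + 1) r)).
  exact: measurableU.
rewrite unit_lebesgueE.
have sub : arc y r `&` `[0, 1[ `<=`
    ball (z - 1) r `|` (ball z r `|` ball (z + 1) r).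
  move=> t /= []; rewrite in_itv/= => tr t01.
  have : dist_int (t - z) < r.
    by rewrite ym opprD addrA -mulrNz dist_intDz.
  move=> /dist_int_ltP[k]; rewrite ltr_norml => /andP[k1 k2].
  have : k \in [:: -1; 0; 1].
    have : (-2)%:~R < k%:~R :> R by rewrite (_ : (-2)%:~R = -2 :> R)//; lra.
    have : k%:~R < 2%:~R :> R by rewrite (_ : 2%:~R = 2 :> R)//; lra.
    by rewrite !ltr_int !inE; lia.
  rewrite !inE => /or3P[] /eqP kE; rewrite kE in k1 k2; [left|right;left|right;right];
    rewrite /ball/= ltr_norml; apply/andP; split;
    move: k1 k2; rewrite ?mulrN1z ?mulr0z ?mulr1z; lra.
apply: (@le_trans _ _ (lebesgue_measure (ball (z - 1) r `|` (ball z r `|` ball (z + 1) r)))).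
  apply: le_measure => //; rewrite inE.
    by apply: measurableI => //; exact: measurable_itv.
  exact: mU3.
apply: le_trans (measureU2 _ _ _) _; [exact: mB|exact: mU2|].
apply: (@le_trans _ _ ((r *+ 2)%:E + ((r *+ 2)%:E + (r *+ 2)%:E))%E).
  apply: leeD; first exact: lB.
  apply: le_trans (measureU2 _ _ _) _; [exact: mB|exact: mB|].
  by apply: leeD; exact: lB.
by rewrite -!EFinD lee_fin; lra.
Qed.

End dist_int_measure.

Section graph_measure.
Context {R : realType}.
Variables (rho : R) (kappa : {posnum R}).
Implicit Types (t u e : R) (x : phase_space R).

Local Notation U := (upper_line rho kappa).

(** The point of the upper bounding graph over the class of [t] modulo 1. *)
Definition graph_point t : phase_space R :=
  (to_circle t, upper_graph_fun rho kappa (to_circle t)).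

Lemma upper_lineDz t (m : int) : U (t + m%:~R) = U t.
Proof.
rewrite /upper_line; congr inf; apply/seteqP; split => _ [n _ <-];
  by exists n => //; rewrite pullbackDz.
Qed.

Lemma val_graph_point t : \val (graph_point t).2 = U t.
Proof.
rewrite upper_graph_funE; have [m ->] := circle_val_to_circle t.
by rewrite upper_lineDz.
Qed.

Lemma ball_graph_pointE x e t : ball x e (graph_point t) <->
  dist_int (t - circle_val x.1) < e /\ `|\val x.2 - U t| < e.
Proof.
have dE : circle_dist x.1 (to_circle t) = dist_int (t - circle_val x.1).
  rewrite /circle_dist; have [m ->] := circle_val_to_circle t.
  by rewrite -dist_intN opprB addrAC dist_intDz.
by rewrite -dE -val_graph_point.
Qed.

Lemma preimage_ball_graph_point x e : graph_point @^-1` ball x e =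
  arc (circle_val x.1) e `&` (U @^-1` ball (\val x.2) e).
Proof. by apply/seteqP; split => t /= /ball_graph_pointE. Qed.

Let measurable_preimage_ball_upper_line (a r : R) : measurable (U @^-1` ball a r).
Proof.
rewrite -[X in measurable X]setTI.
by apply: measurable_upper_line => //; exact: measurable_ball.
Qed.

Lemma measurable_preimage_ball x e : measurable (graph_point @^-1` ball x e).
Proof.
rewrite preimage_ball_graph_point; apply: measurableI; first exact: measurable_arc.
exact: measurable_preimage_ball_upper_line.
Qed.

(** Open sets of the phase space are covered by countably many boxes with
    rational centres, whose preimages are measurable. *)
Lemma measurable_graph_point : measurable_fun [set: measurableTypeR R]
  (graph_point : measurableTypeR R -> borel (phase_space R)).
Proof.
refine (@measurability _ _ (measurableTypeR R) (borel (phase_space R)) _ _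
  (@open (phase_space R)) erefl _).
move=> _ [V oV <-]; rewrite setTI.
pose B (a b : rat) (k : nat) : set R :=
  arc (ratr a) k.+1%:R^-1 `&` (U @^-1` ball (ratr b : R) k.+1%:R^-1).
have mB a b k : measurable (B a b k).
  by apply: measurableI; [exact: measurable_arc|exact: measurable_preimage_ball_upper_line].
pose C (a b : rat) (k : nat) : set R :=
  if `[< B a b k `<=` graph_point @^-1` V >] then B a b k else set0.
have mC a b k : measurable (C a b k) by rewrite /C; case: ifP.
rewrite (_ : graph_point @^-1` V = \bigcup_a \bigcup_b \bigcup_k C a b k).
  apply: bigcupT_measurable_rat => a; apply: bigcupT_measurable_rat => b.
  by apply: bigcupT_measurable => k; exact: mC.
apply/seteqP; split => t /=; last first.
  by move=> [a _ [b _ [k _]]]; rewrite /C; case: asboolP => // sub /sub.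
move=> Vt.
have /nbhs_ballP[e /= e0 eV] : nbhs (graph_point t) V by apply: open_nbhs_nbhs.
have [k ke] : exists k : nat, k.+1%:R^-1 < e / 2.
  have [k _ /(_ k (leqnn k))] : \forall k \near \oo, k.+1%:R^-1 < e / 2.
    by apply: near_infty_natSinv_lt (PosNum _); rewrite divr_gt0.
  by move=> ?; exists k.
have approx (s : R) : exists a : rat, `|s - ratr a| < k.+1%:R^-1.
  have k0 : 0 < k.+1%:R^-1 :> R by rewrite invr_gt0 ltr0n.
  move: (k.+1%:R^-1) k0 => r r0; have sr : s - r < s + r by lra.
  have [a] := rat_in_itvoo sr.
  by rewrite in_itv/= => /andP[a1 a2]; exists a; rewrite ltr_norml; lra.
have [a ta] := approx t; have [b Ub] := approx (U t).
exists a => //; exists b => //; exists k => //; rewrite /C.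
have Bt : B a b k t.
  split; last by rewrite /= /ball/= distrC.
  exact: le_lt_trans (dist_int_le_norm _) ta.
case: asboolP => //; case.
move=> u [ua ub]; apply: eV; apply/ball_graph_pointE; split.
  rewrite -[(graph_point t).1]/(to_circle t); have [m ->] := circle_val_to_circle t.
  rewrite (_ : u - (t + m%:~R) = (u - t) + (- m)%:~R); last by rewrite mulrNz; ring.
  rewrite dist_intDz (_ : u - t = (u - ratr a) + - (t - ratr a)); last by ring.
  apply: le_lt_trans (dist_intD _ _) _; rewrite dist_intN.
  by rewrite (splitr e); apply: ltrD; apply: lt_trans ke; [exact: ua|exact: Bt.1].
rewrite [\val _]val_graph_point (_ : U t - U u = (U t - ratr b) + (ratr b - U u)); last by ring.
apply: le_lt_trans (ler_normD _ _) _.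
by rewrite (splitr e); apply: ltrD; apply: lt_trans ke; [exact: Ub|exact: ub].
Qed.

(** The equality also holds on sets that are not Borel. *)
Lemma upper_graph_measureE :
  upper_graph_measure rho kappa = pushforward unit_lebesgue
    (graph_point : measurableTypeR R -> borel (phase_space R)).
Proof.
apply/funext => A; rewrite /upper_graph_measure /circle_lebesgue.
rewrite /pushforward unit_lebesgueE; congr (lebesgue_measure _).
apply/seteqP; split => t /=.
  move=> [s [p [Ap [q _ qp]] ps] <-]; rewrite -qp in Ap ps.
  rewrite -{}ps; split; last by rewrite in_itv/=; exact: circle_valP.
  by rewrite /graph_point to_circle_val.
rewrite in_itv/= => -[At t01]; exists (to_circle t); last exact: to_circle_id.
by exists (graph_point t) => //; split => //; exists (to_circle t).
Qed.

(** The mass of the ball of radius [e] around [x] for the graph measure. *)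
Definition ball_mass e x : \bar R := unit_lebesgue (graph_point @^-1` ball x e).

Lemma ball_mass_le1 e x : (ball_mass e x <= 1)%E.
Proof. by apply: unit_lebesgue_le1; exact: measurable_preimage_ball. Qed.

Lemma ball_mass_ge0 e x : (0 <= ball_mass e x)%E.
Proof. exact: measure_ge0. Qed.

Lemma ball_mass_le e t : 0 < e -> (ball_mass e (graph_point t) <= (6 * e)%:E)%E.
Proof.
move=> e0; apply: le_trans (unit_lebesgue_arc (circle_val (to_circle t)) e0).
apply: le_measure; rewrite ?inE.
- exact: measurable_preimage_ball.
- exact: measurable_arc.
- by rewrite preimage_ball_graph_point; exact: subIsetl.
Qed.

(** The mass of a ball is lower semicontinuous in the centre: open balls are
    increasing unions of smaller ones. *)
Lemma open_ball_mass_gt e (a : \bar R) : open [set x | (a < ball_mass e x)%E].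
Proof.
rewrite openE => x /= ax.
pose G (n : nat) := graph_point @^-1` ball x (e - n.+1%:R^-1).
have GU : \bigcup_n G n = graph_point @^-1` ball x e.
  apply/seteqP; split => t /=.
    move=> [n _]; apply: le_ball; rewrite gerBl invr_ge0 ler0n//.
  move=> /ball_graph_pointE[]; set p := dist_int _; set q := `|_| => pe qe.
  have e0 : 0 < e - Num.max p q by rewrite subr_gt0 gt_max pe.
  have [n _ /(_ n (leqnn n)) ne] : \forall n \near \oo, n.+1%:R^-1 < e - Num.max p q.
    exact: near_infty_natSinv_lt (PosNum e0).
  exists n => //; apply/ball_graph_pointE; rewrite -/p -/q; split.
    apply: le_lt_trans (_ : p <= Num.max p q) _; first by rewrite le_max lexx.
    by rewrite ltrBrDl -ltrBrDr.
  apply: le_lt_trans (_ : q <= Num.max p q) _; first by rewrite le_max lexx orbT.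
  by rewrite ltrBrDl -ltrBrDr.
have : unit_lebesgue (G n) @[n --> \oo] --> ball_mass e x.
  rewrite /ball_mass -GU; apply: nondecreasing_cvg_mu.
  - by move=> n; exact: measurable_preimage_ball.
  - by rewrite GU; exact: measurable_preimage_ball.
  - move=> n m nm; apply/subsetPset => t; apply: le_ball.
    by rewrite lerD2l lerN2 lef_pV2 ?posrE ?ltr0n// ler_nat.
move=> /(_ _ (open_ereal_gt' ax))[n _ /(_ n (leqnn n)) /= an].
apply/nbhs_ballP; exists n.+1%:R^-1 => [/=|y xy /=]; first by rewrite invr_gt0 ltr0n.
apply: (lt_le_trans an); apply: le_measure; rewrite ?inE.
- exact: measurable_preimage_ball.
- exact: measurable_preimage_ball.
- move=> t xt; rewrite /preimage/= (_ : e = n.+1%:R^-1 + (e - n.+1%:R^-1)); last by ring.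
  by apply: ball_triangle xt; exact: ball_sym.
Qed.

(** The information of the ball around a point: a nonnegative function. *)
Definition information e x : \bar R := (- lne (ball_mass e x))%E.

Lemma information_ge0 e x : (0 <= information e x)%E.
Proof. by rewrite /information oppe_ge0 lne_le0 ball_mass_le1. Qed.

Lemma measurable_information e :
  measurable_fun [set: borel (phase_space R)] (information e).
Proof.
apply: (measurability _ (ErealGenInftyO.measurableE R)) => //.
move=> _ [_ [a ->] <-]; rewrite setTI; apply: sub_sigma_algebra.
rewrite (_ : _ @^-1` _ = [set x | ((expR (- a))%:E < ball_mass e x)%E]).
  exact: open_ball_mass_gt.
have E x : (information e x < a%:E)%E = ((expR (- a))%:E < ball_mass e x)%E.
  rewrite /information lteNl (_ : (- a%:E)%E = lne (expR (- a))%:E); last first.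
    by rewrite lne_EFin ?expR_gt0// expRK.
  by rewrite lte_lne// in_itv/= ?lee_fin ?expR_ge0 ?leey// ball_mass_ge0.
by apply/seteqP; split => x /=; rewrite in_itv/= E.
Qed.

Lemma measurable_information_graph e :
  measurable_fun [set: measurableTypeR R] (fun t => information e (graph_point t)).
Proof.
exact: (measurableT_comp (measurable_information e) measurable_graph_point).
Qed.

(** The information ratio as an integral over the circle; the points outside
    [0, 1) carry no mass. *)
Lemma information_ratioE e : information_ratio (upper_graph_measure rho kappa) e =
  (- (\int[unit_lebesgue]_(t in `[0%R, 1%R[) information e (graph_point t))
    / (ln e)%:E)%E.
Proof.
rewrite /information_ratio upper_graph_measureE; congr (_ / _)%E.
transitivity (\int[pushforward unit_lebesgue
    (graph_point : measurableTypeR R -> borel (phase_space R))]_x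
      - information e x)%E.
  by congr (integral _ _ _); apply/funext => x; rewrite /information oppeK.
rewrite integral_ge0N; [exact: measurable_graph_point|move=> mg|]; last first.
  by move=> x _; exact: information_ge0.
congr (- _)%E.
rewrite (ge0_integral_pushforward measurable_graph_point)//; last 2 first.
- exact: measurable_information.
- by move=> x _; exact: information_ge0.
rewrite preimage_setT.
have m01 : measurable (`[(0 : R), 1[ : set R) by exact: measurable_itv.
rewrite -(setUv (`[0, 1[%classic : set R)) ge0_integral_setU//; last 4 first.
- exact: measurableC.
- by rewrite setUv; exact: measurable_information_graph.
- by move=> t _; exact: information_ge0.
- by rewrite disj_set2E setICr.
rewrite [X in (_ + X)%E]null_set_integral ?adde0//.
- exact: measurableC.
- exact: measurable_funS (measurable_information_graph e).
- by rewrite unit_lebesgueE setICl measure0.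
Qed.

End graph_measure.

(** * A large set on which the upper bounding graph is Lipschitz *)

Section good_set.
Context {R : realType}.
Implicit Types c d rho a delta : R.

(** The points of [0, 1) whose backward orbit approaches [0] at most
    geometrically fast. *)
Definition good_set rho a : set R := `[0, 1[%classic `&`
  \bigcap_i ~` arc (i.+1%:R * rho) (a / (2 ^ i.+1)%:R).

Lemma measurable_good_set rho a : measurable (good_set rho a).
Proof.
apply: measurableI; first exact: measurable_itv.
apply: bigcapT_measurable => i; apply: measurableC; exact: measurable_arc.
Qed.

Lemma bad_set_small rho a : 0 < a ->
  (unit_lebesgue (`[0%R, 1%R[%classic `\` good_set rho a) <= (6 * a)%:E)%E.
Proof.
move=> a0; have mG := measurable_good_set rho a.
have r0 (i : nat) : 0 < a / (2 ^ i.+1)%:R by rewrite divr_gt0// ltr0n expn_gt0.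
apply: (@le_trans _ _ (\sum_(0 <= i <oo)
    unit_lebesgue (arc (i.+1%:R * rho) (a / (2 ^ i.+1)%:R)))%E).
  apply: measure_sigma_subadditive => [i||].
  - exact: measurable_arc.
  - by apply: measurableD => //; exact: measurable_itv.
  - move=> t [t01 /= nG]; apply: contrapT => nU; apply: nG; split => // i _ ti.
    by apply: nU; exists i.
apply: (@le_trans _ _ (\sum_(0 <= i <oo) (6 * a / (2 ^ i.+1)%:R)%:E)%E).
  apply: lee_nneseries => [i _ _|i _]; first exact: measure_ge0.
  by apply: le_trans (unit_lebesgue_arc _ (r0 i)) _; rewrite lee_fin mulrA.
by apply: epsilon_trick0; rewrite mulr_ge0// ltW.
Qed.

Lemma slow_approach_good_set c d : 0 < c -> exists2 q : R, 0 < q <= 1 &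
  forall rho, diophantine c d rho -> forall a, 0 < a -> exists2 b : R, 0 < b &
  forall t, good_set rho a t -> slow_approach rho b q t.
Proof.
move=> c0; have [q q0 qP] := @prod_dist_int_lower R c d c0.
pose s : R := cos 1 / 2; have s0 : 0 < s by rewrite divr_gt0// cos1_gt0.
exists (Num.min (s * q) 1) => [|rho dio a a0].
  by rewrite lt_min ltr01 mulr_gt0//= ge_min lexx orbT.
have [b b0 bP] := qP rho dio a a0; exists b => // t [t01 tG] j.
have far i : (0 < i)%N -> a * 2^-1 ^+ i <= dist_int (t - i%:R * rho).
  case: i => // i _; have := tG i I; rewrite /= /arc/= => /negP.
  by rewrite -leNgt natrX exprVn.
apply: le_trans (_ : b * (s * q) ^+ j <= _).
  rewrite ler_pM2l// lerXn2r ?nnegrE ?le_min ?ge_min ?lexx ?ler01 ?andbT//;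
    by rewrite mulr_ge0// ltW.
rewrite exprMn mulrCA.
apply: le_trans (ler_wpM2l (exprn_ge0 j (ltW s0)) (bP t far j)) _.
have -> : s ^+ j = \prod_(1 <= i < j.+1) s by rewrite prodr_const_nat subn1.
rewrite -big_split/=.
apply: ler_prod => i _; rewrite mulr_ge0 ?dist_int_ge0 ?(ltW s0)//=.
by rewrite /s mulrAC ler_pM2r ?invr_gt0//; exact: abs_sin_pi_lower.
Qed.

Lemma upper_line_lipschitz_large c d : 0 < c ->
  exists kappa0 : {posnum R}, forall rho, diophantine c d rho ->
  forall kappa : {posnum R}, kappa0%:num <= kappa%:num ->
  forall delta, 0 < delta -> exists (A : set R) (L : R),
  [/\ measurable A, A `<=` `[0, 1[%classic,
      (unit_lebesgue (`[0%R, 1%R[%classic `\` A) <= delta%:E)%E, 0 < L &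
      forall t u, A t -> A u ->
        `|upper_line rho kappa t - upper_line rho kappa u| <= L * `|t - u|].
Proof.
move=> c0; have [q /andP[q0 q1] qP] := @slow_approach_good_set c d c0.
have q8 : 0 < q ^+ 8 by rewrite exprn_gt0.
have k0 : 0 < Num.max 8 (2 / q ^+ 8) by rewrite lt_max ltr0n.
exists (PosNum k0) => rho dio kappa /=; rewrite ge_max => /andP[k8 kq] delta delta0.
have a0 : 0 < delta / 6 by rewrite divr_gt0.
have [b b0 bP] := qP rho dio _ a0.
exists (good_set rho (delta / 6)), (2 * pi * (b * q) ^- 8); split.
- exact: measurable_good_set.
- exact: subIsetl.
- by apply: le_trans (bad_set_small rho a0) _; rewrite lee_fin mulrC divfK.
- by rewrite !mulr_gt0 ?pi_gt0// invr_gt0 exprn_gt0// mulr_gt0.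
- move=> t u /bP st /bP su; apply: upper_line_lipschitz => n.
  by apply: pullback1_lipschitz => //; rewrite -ler_pdivrMr.
Qed.

End good_set.

(** * The information dimension *)

Section information_bounds.
Context {R : realType}.
Variables (rho : R) (kappa : {posnum R}).
Implicit Types (t u e : R).

Local Notation U := (upper_line rho kappa).
Local Notation I01 := (`[0%R, 1%R[%classic : set R).
Local Notation h e := (fun t => information rho kappa e (graph_point rho kappa t)).

Local Open Scope ereal_scope.

Let m01 : measurable I01. Proof. exact: measurable_itv. Qed.

Let I01_unit t : I01 t -> (0 <= t <= 1)%R.
Proof. by rewrite /= in_itv/= => /andP[-> /ltW->]. Qed.

Lemma information_lower e : (0 < e)%R -> (6 * e <= 1)%R ->
  (- ln (6 * e))%:E <= \int[unit_lebesgue]_(t in I01) h e t.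
Proof.
move=> e0 e1.
have e6 : (0 < 6 * e)%R by rewrite mulr_gt0.
have <- : \int[unit_lebesgue]_(t in I01) cst (- ln (6 * e))%:E t = (- ln (6 * e))%:E.
  rewrite integral_cst// unit_lebesgueE setIid lebesgue_measure_itv/= lte_fin.
  by rewrite ltr01 oppr0 adde0 mule1.
apply: ge0_le_integral => //.
- by move=> t _; rewrite lee_fin oppr_ge0 ln_le0.
- by apply: measurable_funS (measurable_information_graph rho kappa e).
- move=> t _; rewrite /information EFinN leeN2 -lne_EFin//.
  rewrite lee_lne ?in_itv/= ?lee_fin ?(ltW e6) ?leey ?ball_mass_ge0//.
  exact: ball_mass_le.
Qed.

(** On a set of points that are pairwise [e]-close along the graph, every ball
    of radius [e] has at least the mass of the set. *)
Lemma information_cell e w (E : set R) : (0 < w)%R -> measurable E ->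
  (forall t u, E t -> E u -> (`|t - u| < e)%R /\ (`|U t - U u| < e)%R) ->
  \int[unit_lebesgue]_(t in E) h e t <= w%:E + (- ln w)%:E * unit_lebesgue E.
Proof.
move=> w0 mE close; apply: integral_cell => //.
- exact: measurable_information_graph.
- by move=> t; exact: information_ge0.
- exact: unit_lebesgue_fin.
move=> t Et; rewrite -unit_lebesgue_fin// leeN2.
rewrite lee_lne ?in_itv/= ?leey ?measure_ge0//.
apply: le_measure; rewrite ?inE//; first exact: measurable_preimage_ball.
move=> u Eu; apply/ball_graph_pointE; have [tu Utu] := close t u Et Eu.
split; last by rewrite val_graph_point.
have [m ->] := circle_val_to_circle t.
rewrite opprD addrA -mulrNz dist_intDz; apply: le_lt_trans (dist_int_le_norm _) _.
by rewrite distrC.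
Qed.

Let mU : measurable_fun [set: R] U := measurable_upper_line rho kappa.

(* points in the same strip of width [n^-1 < e] are [e]-close *)
Let same_strip (n k : nat) (x y e : R) : (e^-1 < n%:R)%R -> (0 < e)%R ->
  (k%:R <= n%:R * x < k.+1%:R)%R -> (k%:R <= n%:R * y < k.+1%:R)%R ->
  (`|x - y| < e)%R.
Proof.
move=> ne e0 /andP[x1 x2] /andP[y1 y2].
have n0 : (0 < n%:R :> R)%R by apply: lt_trans ne; rewrite invr_gt0.
have ne1 : (1 < n%:R * e)%R by rewrite -ltr_pdivrMr// div1r.
rewrite -(ltr_pM2l n0) -[X in (X * `|_|)%R](ger0_norm (ltW n0)) -normrM.
apply: lt_trans ne1; rewrite -natr1 in x2 y2.
by rewrite ltr_norml mulrBr; lra.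
Qed.

Let truncS_bound (x : R) : (0 <= x)%R -> exists n : nat,
  [/\ (0 < n)%N, (x < n%:R)%R & (n.+1%:R <= x + 2)%R].
Proof.
move=> x0; exists (Num.truncn x).+1; split => //; first exact: truncnS_gt.
by rewrite -addn2 natrD lerD2r truncn_le.
Qed.

Let measurable_strip (E : set R) (f : R -> R) (n k : nat) : measurable E ->
  measurable_fun [set: R] f ->
  measurable (strip E f n k).
Proof.
move=> mE mf; apply: measurableI => //; rewrite -[X in measurable X]setTI.
have mnf : measurable_fun [set: R] (fun t => n%:R * f t)%R by exact: measurable_funM.
rewrite (_ : [set t | _] = (fun t => n%:R * f t)%R @^-1` `[k%:R, k.+1%:R[%classic).
  by apply: mnf => //; exact: measurable_itv.
by apply/seteqP; split => t /=; rewrite in_itv.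
Qed.

(** Where the graph is Lipschitz, of order [1 / e] cells are enough. *)
Lemma information_upper_lipschitz e L (A : set R) : (0 < e <= 1)%R ->
  measurable A -> A `<=` I01 -> (0 < L)%R ->
  (forall t u, A t -> A u -> (`|U t - U u| <= L * `|t - u|)%R) ->
  \int[unit_lebesgue]_(t in A) h e t <=
    (L + 3)%:E + (- ln e)%:E * unit_lebesgue A.
Proof.
move=> /andP[e0 e1] mA A01 L0 lip.
have L1 : (0 < L + 1)%R by rewrite addr_gt0.
have [n [n0 nL n2]] := @truncS_bound ((L + 1) / e) ltac:(by rewrite divr_ge0// ltW).
apply: le_trans (@integral_strips _ _ _ unit_lebesgue (h e) _ _ A id n e (- ln e) mA _ _ n0 _) _.
- exact: measurable_information_graph.
- by move=> t; exact: information_ge0.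
- exact: measurable_id.
- by move=> t /A01/I01_unit.
- move=> k; apply: information_cell => //; first exact: measurable_strip.
  move=> t u [At tk] [Au uk].
  have eL : (0 < e / (L + 1))%R by rewrite divr_gt0.
  have tu : (`|t - u| < e / (L + 1))%R by apply: (same_strip _ _ tk uk); rewrite ?invf_div.
  have tu' : (`|t - u| * (L + 1) < e)%R by rewrite -ltr_pdivlMr.
  have := normr_ge0 (t - u)%R; have := lip t u At Au.
  by split; nra.
rewrite leeD2r// lee_fin.
apply: le_trans (_ : ((L + 1) / e + 2) * e <= _)%R; first by rewrite ler_wpM2r// ltW.
by rewrite mulrDl divfK ?gt_eqF//; lra.
Qed.

(** Of order [1 / e ^+ 2] cells are always enough. *)
Lemma information_upper_trivial e (B : set R) : (0 < e <= 1)%R ->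
  measurable B -> B `<=` I01 ->
  \int[unit_lebesgue]_(t in B) h e t <=
    9%:E + (- ln (e ^+ 2))%:E * unit_lebesgue B.
Proof.
move=> /andP[e0 e1] mB B01.
have [n [n0 ne n2]] := @truncS_bound (e^-1) ltac:(by rewrite invr_ge0 ltW).
apply: le_trans (@integral_strips _ _ _ unit_lebesgue (h e) _ _ B id n
  (n.+1%:R * e ^+ 2) (- ln (e ^+ 2)) mB _ _ n0 _) _.
- exact: measurable_information_graph.
- by move=> t; exact: information_ge0.
- exact: measurable_id.
- by move=> t /B01/I01_unit.
- move=> k; have mC : measurable (strip B id n k) by exact: measurable_strip.
  apply: (@integral_strips _ _ _ unit_lebesgue (h e) _ _ (strip B id n k) U) => //.
  + exact: measurable_information_graph.
  + by move=> t; exact: information_ge0.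
  + by move=> t _; rewrite upper_line_ge0 upper_line_le1.
  + move=> j; apply: information_cell; first by rewrite exprn_gt0.
      exact: measurable_strip.
    move=> t u [[_ tk] tj] [[_ uk] uj].
    by split; [exact: (same_strip ne e0 tk uk)|exact: (same_strip ne e0 tj uj)].
rewrite leeD2r// lee_fin.
have ne3 : (n.+1%:R * e <= 3)%R.
  apply: le_trans (_ : (e^-1 + 2) * e <= _)%R; first by rewrite ler_wpM2r// ltW.
  by rewrite mulrDl mulVf ?gt_eqF//; lra.
rewrite (_ : n.+1%:R * (n.+1%:R * e ^+ 2) = (n.+1%:R * e) * (n.+1%:R * e))%R; last by ring.
rewrite (_ : 9 = 3 * 3)%R; last by ring.
by apply: ler_pM => //; rewrite mulr_ge0// ltW.
Qed.

Lemma information_upper e delta L (A : set R) : (0 < e <= 1)%R ->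
  measurable A -> A `<=` I01 -> (0 < L)%R ->
  unit_lebesgue (I01 `\` A) <= delta%:E ->
  (forall t u, A t -> A u -> (`|U t - U u| <= L * `|t - u|)%R) ->
  \int[unit_lebesgue]_(t in I01) h e t <=
    (L + 12 + (1 + 2 * delta) * - ln e)%:E.
Proof.
move=> e01 mA A01 L0 Ad lip; have /andP[e0 e1] := e01.
have mB : measurable (I01 `\` A) by exact: measurableD.
have le0 : (0 <= - ln e)%R by rewrite oppr_ge0 ln_le0.
rewrite -(setDUK A01) ge0_integral_setU//; last 3 first.
- by apply: measurable_funS (measurable_information_graph rho kappa e).
- by move=> t _; exact: information_ge0.
- by rewrite disj_set2E setDIK.
apply: le_trans (leeD (information_upper_lipschitz e01 mA A01 L0 lip)
  (information_upper_trivial e01 mB (@subDsetl _ _ _))) _.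
rewrite lnXn//.
apply: (@le_trans _ _ ((L + 3)%:E + (- ln e)%:E * 1 + (9%:E + (- (ln e *+ 2))%:E * delta%:E))).
  apply: leeD; apply: leeD2l; apply: lee_wpmul2l; rewrite ?lee_fin ?unit_lebesgue_le1//.
  by rewrite -mulNrn mulrn_wge0.
by rewrite mule1 -!EFinM -!EFinD lee_fin; lra.
Qed.

End information_bounds.

Section limit.
Context {R : realType}.
Local Open Scope ereal_scope.

Lemma limf_esup_close (f : R -> \bar R) (l : R) (F : set_system R) :
  ProperFilter F ->
  (forall eta : R, (0 < eta)%R ->
    \forall x \near F, (l - eta)%:E <= f x <= (l + eta)%:E) ->
  limf_esup f F = l%:E.
Proof.
move=> PF close; rewrite limf_esupE; apply/eqP; rewrite eq_le; apply/andP; split.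
  apply/lee_addgt0Pr => eta eta0; apply: ge_ereal_inf.
  exists (ereal_sup [set f x | x in [set x | (l - eta)%:E <= f x <= (l + eta)%:E]]).
    by eexists; [exact: close eta0|].
  by apply: ge_ereal_sup => _ [x /= /andP[_ fx] <-]; rewrite -EFinD.
apply: le_ereal_inf_tmp => _ [V FV <-].
apply/lee_subgt0Pr => eta eta0; rewrite -EFinB.
have [x [Vx /andP[fx _]]] := filter_ex (filterI FV (close eta eta0)).
by apply: le_trans fx _; apply: ereal_sup_ubound; exists x.
Qed.

Lemma limf_einf_close (f : R -> \bar R) (l : R) (F : set_system R) :
  ProperFilter F ->
  (forall eta : R, (0 < eta)%R ->
    \forall x \near F, (l - eta)%:E <= f x <= (l + eta)%:E) ->
  limf_einf f F = l%:E.
Proof.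
move=> PF close; rewrite /limf_einf (@limf_esup_close _ (- l)%R)//.
  by rewrite EFinN oppeK.
move=> eta eta0; have := close eta eta0; apply: filterS => x /andP[fl fr].
have -> : (- l + eta = - (l - eta))%R by ring.
by rewrite -opprD !EFinN !leeN2 fr fl.
Qed.

End limit.

Theorem corollary1p4 (R : realType) (c d : R) (c_gt0 : 0 < c) (d_gt1 : 1 < d) :
  exists kappa0 : {posnum R},
    forall rho : R, irrational rho -> diophantine c d rho ->
    forall kappa : {posnum R}, kappa0%:num <= kappa%:num ->
      has_information_dimension (upper_graph_measure rho kappa) 1%:E.
Proof.
have [kappa0 lip] := @upper_line_lipschitz_large R c d c_gt0.
exists kappa0 => rho _ dio kappa kk.
suff close (eta : R) : 0 < eta -> \forall e \near 0^'+,
    ((1 - eta)%:E <= information_ratio (upper_graph_measure rho kappa) e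
      <= (1 + eta)%:E)%E.
  by split; [exact: limf_einf_close|exact: limf_esup_close].
move=> eta0; have delta0 : 0 < eta / 4 by rewrite divr_gt0.
have [A [L [mA A01 Ad L0 lipA]]] := lip rho dio kappa kk _ delta0.
(* both error terms are absorbed once [- ln e] exceeds [M] *)
pose M := (L + 12 + ln 6) / (eta / 2) + ln 6.
near=> e.
have e0 : 0 < e by [].
have ln60 : 0 < ln 6 :> R by rewrite ln_gt0// ltr1n.
have eM : e < expR (- M) by near: e; apply: nbhs_right_lt; exact: expR_gt0.
have Mln : M < - ln e.
  by rewrite ltrNr -(expRK (- M)) ltr_ln// posrE expR_gt0.
have M0 : ln 6 < M by rewrite ltrDr divr_gt0// ?divr_gt0// addr_gt0// addr_gt0.
have lnE : 0 < - ln e by apply: lt_trans Mln; apply: lt_trans M0.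
have e1 : e <= 1.
  rewrite leNgt; apply/negP => e1.
  by have := ln_gt0 e1; rewrite -oppr_lt0 ltNge ltW.
have e6 : 6 * e <= 1.
  rewrite -ler_ln ?posrE ?mulr_gt0// ln1 lnM ?posrE//.
  by have := lt_trans M0 Mln; lra.
have bigM : L + 12 + ln 6 < - ln e * (eta / 2).
  rewrite -ltr_pdivrMr ?divr_gt0//; apply: lt_trans Mln.
  by rewrite /M ltrDl.
rewrite information_ratioE.
have := information_lower rho kappa e0 e6.
have e01 : 0 < e <= 1 by rewrite e0.
have := information_upper e01 mA A01 L0 Ad lipA.
case: integral => [j| |] //=; rewrite !lee_fin => jup jlow.
rewrite inver lt_eqF -?oppr_gt0// -EFinM !lee_fin.
have -> : - j * (ln e)^-1 = j / (- ln e) by rewrite invrN mulrN mulNr.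
rewrite ler_pdivlMr// ler_pdivrMr//.
rewrite lnM ?posrE// in jlow.
by apply/andP; split; lra.
Unshelve. all: by end_near. Qed.
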